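(* Let $\mathcal{G}$ be a minor-closed class such that every minimal forbidden minor of $\mathcal{G}$ is 2-connected. Let $s$ be the maximum integer such that $K_{s,t}\in\mathcal{G}$ for every $t\in\mathbb{N}$. Then for every forest $T$, $$C(T,\mathcal{G},n)=\Theta(n^{\alpha_s(T)})\quad(n\to\infty).$$
   Context: All graphs are finite, simple and undirected. A graph class $\mathcal{G}$ is minor-closed if some graph is not in $\mathcal{G}$ and every minor of every graph in $\mathcal{G}$ is in $\mathcal{G}$; a minimal forbidden minor of $\mathcal{G}$ is a graph not in $\mathcal{G}$ all of whose proper minors are in $\mathcal{G}$. For graphs $H,G$, $C(H,G)$ is the number of subgraphs of $G$ isomorphic to $H$, and $C(H,\mathcal{G},n):=\max\{C(H,G):G\in\mathcal{G},|V(G)|=n\}$. For a graph $G$ and $s\in\mathbb{N}_0$, $\alpha_s(G)$ is the maximum size of a stable set in the subgraph of $G$ induced by the vertices of degree at most $s$ in $G$. $\Theta(n^a)$ means bounded above and below by positive constant multiples of $n^a$ for all sufficiently large $n$. *)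

(* Defs.v *)
From mathcomp Require Import all_boot.
(* Not imported: its set0, setT and setUC would shadow those of finset. *)
From mathcomp Require classical_sets.

Set Implicit Arguments.
Unset Strict Implicit.
Unset Printing Implicit Defensive.

Record sgraph := SGraph {
  vertex :> finType;
  adj : rel vertex;
  adj_sym : symmetric adj;
  adj_irrefl : irreflexive adj }.

Notation "x -- y" := (adj x y) (at level 30, no associativity).

Definition edges (G : sgraph) : {set {set G}} :=
  [set e | [exists x, [exists y, (x -- y) && (e == [set x; y])]]].

Definition degree (G : sgraph) (x : G) : nat := #|[set y | x -- y]|.

Definition isomorphic (G H : sgraph) : bool :=
  [exists f : {ffun G -> H},
    [&& injectiveb f, [forall y, y \in codom f]
      & [forall x, [forall y, (f x -- f y) == (x -- y)]]]].

(* The empty set does not induce a connected subgraph. *)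
Definition connected_in (G : sgraph) (A : {set G}) : bool :=
  (A != set0) &&
  [forall x in A, [forall y in A,
    connect [rel u v | [&& u \in A, v \in A & u -- v]] x y]].

(* In particular K_2 is not 2-connected. *)
Definition two_connected (G : sgraph) : bool :=
  (2 < #|G|) && [forall X : {set G}, (#|X| < 2) ==> connected_in (~: X)].

Definition forest (G : sgraph) : Prop :=
  forall c : seq G, ucycle (@adj G) c -> size c <= 2.

(* [minor H G]: H arises, up to isomorphism, from a subgraph of G by contracting
   disjoint connected vertex sets [B x], the branch sets, to single vertices. *)
Definition minor (H G : sgraph) : Prop :=
  exists B : H -> {set G},
    [/\ forall x, connected_in (B x),
        forall x y, x != y -> [disjoint B x & B y]
      & forall x y, x -- y -> exists u v, [/\ u \in B x, v \in B y & u -- v]].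

Definition proper_minor (H G : sgraph) : Prop := minor H G /\ ~~ isomorphic H G.

(* Invariance of a class under isomorphism is not required separately: it follows
   from [minor_closed], isomorphic graphs being minors of each other. *)
Definition graph_class := sgraph -> Prop.

Definition minor_closed (P : graph_class) : Prop :=
  (exists G, ~ P G) /\ (forall G H, P G -> minor H G -> P H).

Definition minimal_forbidden_minor (P : graph_class) (G : sgraph) : Prop :=
  ~ P G /\ (forall H, proper_minor H G -> P H).

Section CompleteBipartite.
Variables s t : nat.

Definition Kst_adj : rel ('I_s + 'I_t)%type := fun x y =>
  match x, y with
  | inl _, inr _ | inr _, inl _ => true
  | _, _ => false
  end.

Lemma Kst_sym : symmetric Kst_adj. Proof. by move=> [x|x] [y|y]. Qed.

Lemma Kst_irrefl : irreflexive Kst_adj. Proof. by case. Qed.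

Definition Kst : sgraph := SGraph Kst_sym Kst_irrefl.

End CompleteBipartite.

Section Subgraphs.
Variable G : sgraph.

(* A subgraph of G is encoded as a pair (vertex set, edge set). *)
Definition is_subgraph (S : {set G} * {set {set G}}) : bool :=
  (S.2 \subset edges G) && [forall e in S.2, e \subset S.1].

Variable S : {set G} * {set {set G}}.

(* The conjunct [val x -- val y] is redundant when [is_subgraph S] holds. It makes
   the relation irreflexive for arbitrary S. *)
Definition sub_adj : rel {x : G | x \in S.1} :=
  fun x y => (val x -- val y) && ([set val x; val y] \in S.2).

Lemma sub_adj_sym : symmetric sub_adj.
Proof. by move=> x y; rewrite /sub_adj adj_sym setUC. Qed.

Lemma sub_adj_irrefl : irreflexive sub_adj.
Proof. by move=> x; rewrite /sub_adj adj_irrefl. Qed.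

Definition graph_of_sub : sgraph := SGraph sub_adj_sym sub_adj_irrefl.

End Subgraphs.

Definition copies (H G : sgraph) : nat :=
  #|[set S | is_subgraph S && isomorphic H (@graph_of_sub G S)]|.

Definition is_maximum (A : nat -> Prop) (m : nat) : Prop :=
  A m /\ (forall k, A k -> k <= m).

(* The number of subgraphs of an n-vertex graph is bounded in terms of n, so the
   maximum exists as soon as P contains a graph on n vertices; the value is 0
   otherwise. *)
Definition max_copies (H : sgraph) (P : graph_class) (n : nat) : nat :=
  classical_sets.xget 0 (is_maximum
    (fun m => exists G : sgraph, [/\ P G, #|G| = n & copies H G = m])).

Definition stable (G : sgraph) (A : {set G}) : bool :=
  [forall x in A, [forall y in A, ~~ (x -- y)]].

Definition alpha (s : nat) (G : sgraph) : nat :=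
  \max_(A : {set G} | (A \subset [set x | degree x <= s]) && stable A) #|A|.

(* Main.v *)
(** For the lower bound, replace every vertex of an optimal stable set A of vertices of
degree at most s by many copies with the same neighbours. A 2-connected minor of the
resulting graph lives in a set W that no vertex disconnects; its projection to the
forest T is a star centred in A, so the minor is already a minor of some K_{s,t}, and
cannot be a minimal forbidden minor.

For the upper bound, some K_{s+1,t} is not a minor of any graph of the class, so these
graphs have linearly many edges (Mader). By Koenig's theorem the vertices of T of degree at
most s are covered by alpha_s(T) vertices and edges of T, hence an embedding of T has
O(n^alpha_s(T)) restrictions to them. If too many embeddings had the same restriction,
there would be t of them that agree outside a nonempty set U of vertices of degree
greater than s and have disjoint images on U. In a forest a component D of U has
at least s + 1 neighbours outside D, as s >= 1; their common images and the images of D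
form a K_{s+1,t} minor. *)
Require Import Defs.
From mathcomp Require Import all_boot.
From mathcomp Require Import boolp.
From mathcomp Require Import zify.

Set Implicit Arguments.
Unset Strict Implicit.
Unset Printing Implicit Defensive.

(** * Connected vertex sets *)

(** Trades paths for closure: an induction along a path becomes the choice of a set [X] closed under
    adjacency inside [A]. Connectivity is mostly used in this form below. *)
Lemma connected_inP (G : sgraph) (A : {set G}) :
  reflect (A != set0 /\ forall X : {set G},
             (exists2 a, a \in A & a \in X) ->
             (forall u v, u \in A -> v \in A -> u \in X -> u -- v -> v \in X) ->
             A \subset X)
          (connected_in A).
Proof.
apply: (iffP andP) => -[A0 conA]; split=> //.
  move=> X [a aA aX] clX; apply/subsetP => b bA.
  have /connectP[p] := implyP (forallP (implyP (forallP conA a) aA) b) bA.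
  elim: p a aA aX => [|c p IHp] a aA aX /=; first by move=> _ ->.
  case/andP=> /and3P[_ cA ac]; apply: IHp => //; exact: clX ac.
apply/forall_inP => x xA; apply/forall_inP => y yA.
set r := (X in connect X).
suff /subsetP/(_ y yA) : A \subset [set z | connect r x z] by rewrite inE.
apply: conA; first by exists x; rewrite // inE.
move=> u v uA vA; rewrite !inE => xu uv; apply: connect_trans xu _.
by apply: connect1; rewrite /r /= uA vA.
Qed.

Lemma connected_in_neq0 (G : sgraph) (A : {set G}) : connected_in A -> A != set0.
Proof. by case/andP. Qed.

Lemma connected_in1 (G : sgraph) (x : G) : connected_in [set x].
Proof.
apply/connected_inP; split; first by apply/set0Pn; exists x; rewrite inE.
by move=> X [a]; rewrite inE => /eqP -> xX _; rewrite sub1set.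
Qed.

(** A closed set that meets one [C x] contains it and then spreads along [A]. Allowing [u = v]
    covers maps that identify adjacent vertices as well as compositions of minors. *)
Lemma connected_in_bigcup (G K : sgraph) (C : G -> {set K}) (A : {set G}) :
    connected_in A -> {in A, forall x, connected_in (C x)} ->
    {in A &, forall x y, x -- y ->
       exists u v, [/\ u \in C x, v \in C y & (u = v) \/ (u -- v)]} ->
  connected_in (\bigcup_(x in A) C x).
Proof.
move=> /connected_inP[/set0Pn[a aA] conA] conC tch; apply/connected_inP; split.
  have /set0Pn[u uC] := connected_in_neq0 (conC a aA).
  by apply/set0Pn; exists u; apply/bigcupP; exists a.
move=> X [u /bigcupP[x xA uC] uX] clX.
have fullC y v : y \in A -> v \in C y -> v \in X -> C y \subset X.
  move=> yA vC vX; have /connected_inP[_] := conC y yA; apply; first by exists v.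
  by move=> w z wC zC; apply: clX; apply/bigcupP; exists y.
apply/bigcupsP => y yA.
have /subsetP/(_ y yA) : A \subset [set z | C z \subset X].
  apply: conA; first by exists x; rewrite // inE (fullC x u).
  move=> w z wA zA; rewrite !inE => /subsetP sCX wz.
  have [a1 [a2 [a1C a2C aa]]] := tch w z wA zA wz.
  apply: (fullC z a2) => //; case: aa => [<-|aa]; first exact: sCX.
  by apply: (clX a1) => //; [apply/bigcupP; exists w | apply/bigcupP; exists z | exact: sCX].
by rewrite inE.
Qed.

Lemma connected_in_imset (G K : sgraph) (f : G -> K) (A : {set G}) :
    connected_in A ->
    {in A &, forall x y, x -- y -> (f x = f y) \/ (f x -- f y)} ->
  connected_in (f @: A).
Proof.
move=> conA fadj; have -> : f @: A = \bigcup_(x in A) [set f x].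
  apply/setP => z; apply/imsetP/bigcupP => -[x xA].
    by move->; exists x; rewrite ?inE.
  by rewrite inE => /eqP ->; exists x.
apply: connected_in_bigcup => // [x _|x y xA yA xy]; first exact: connected_in1.
by exists (f x), (f y); rewrite !inE !eqxx; split=> //; exact: fadj.
Qed.

Lemma component_exists (G : sgraph) (U : {set G}) : U != set0 ->
  exists D : {set G}, [/\ connected_in D, D \subset U
    & forall x y, x \in D -> y \in U -> x -- y -> y \in D].
Proof.
case/set0Pn => x xU.
set r := [rel u v : G | [&& u \in U, v \in U & u -- v]].
pose D := [set y | connect r x y].
have DU : D \subset U.
  apply/subsetP => y; rewrite inE => /connectP[p].
  elim: p x xU @D => [|c p IHp] x xU /=; first by move=> _ ->.
  by case/andP=> /and3P[_ cU _]; exact: IHp.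
have clD a b : a \in D -> b \in U -> a -- b -> b \in D.
  move=> aD bU ab; move: (aD); rewrite !inE => xa; apply: connect_trans xa _.
  by apply: connect1; rewrite /= bU ab (subsetP DU).
exists D; split=> //; apply/connected_inP; split.
  by apply/set0Pn; exists x; rewrite inE.
have symr : symmetric r by move=> u v; rewrite /r /= andbCA adj_sym.
move=> X [a aD aX] clX; apply/subsetP => b bD.
have : connect r a b.
  move: aD bD; rewrite !inE => xa; apply: connect_trans.
  by rewrite (sym_connect_sym symr).
case/connectP => p; elim: p a aD aX => [|c p IHp] a aD aX /=; first by move=> _ ->.
case/andP=> /and3P[_ cU ac].
have cD := clD _ _ aD cU ac.
by apply: IHp => //; exact: clX ac.
Qed.

(** * Minors and minimal forbidden minors *)

Lemma minor_trans (G H K : sgraph) : minor H G -> minor G K -> minor H K.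
Proof.
move=> [B [conB disB adjB]] [C [conC disC adjC]].
exists (fun x => \bigcup_(y in B x) C y); split.
- move=> x; apply: connected_in_bigcup => // y z _ _ /adjC [u [v [? ? ?]]].
  by exists u, v; split=> //; right.
- move=> x y xy; apply/pred0P => u /=; apply/negP => /andP[/bigcupP[a aB uC] /bigcupP[b bB uC']].
  have [ab|ab] := eqVneq a b.
    by have /pred0P/(_ a) := disB x y xy; rewrite /= aB ab bB.
  by have /pred0P/(_ u) := disC a b ab; rewrite /= uC uC'.
- move=> x y /adjB[a [b [aB bB /adjC[u [v [uC vC uv]]]]]].
  by exists u, v; split=> //; apply/bigcupP; [exists a | exists b].
Qed.

Lemma minor_of_embedding (H G : sgraph) (f : H -> G) : injective f ->
  (forall x y, x -- y -> f x -- f y) -> minor H G.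
Proof.
move=> f_inj f_adj; exists (fun x => [set f x]); split=> [x|x y xy|x y xy].
- exact: connected_in1.
- by rewrite disjoints1 inE (inj_eq f_inj).
- by exists (f x), (f y); rewrite !inE !eqxx; split=> //; exact: f_adj.
Qed.

Lemma minor_refl (G : sgraph) : minor G G.
Proof. exact: (@minor_of_embedding G G id). Qed.

Lemma Kst_minor_mono (s s' t : nat) : s <= s' -> minor (Kst s t) (Kst s' t).
Proof.
move=> ss'; apply: (@minor_of_embedding (Kst s t) (Kst s' t)
  (fun x : 'I_s + 'I_t => match x with inl i => inl (widen_ord ss' i) | inr j => inr j end)).
  move=> [i|i] [j|j] //= [ij]; last by rewrite ij.
  by congr inl; apply: val_inj.
by move=> [i|i] [j|j].
Qed.

Lemma disjoint_inj (I X : finType) (B : I -> {set X}) :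
    (forall x y, x != y -> [disjoint B x & B y]) ->
  forall x y u, u \in B x -> u \in B y -> x = y.
Proof.
move=> disB x y u ux uy; have [//|/disB/pred0P/(_ u)] := eqVneq x y.
by rewrite /= ux uy.
Qed.

Lemma branch_representatives (I : finType) (G : sgraph) (B : I -> {set G}) :
    (forall x, connected_in (B x)) -> (forall x y, x != y -> [disjoint B x & B y]) ->
  exists2 f : I -> G, injective f & forall x, f x \in B x.
Proof.
move=> conB disB; have ne x : exists u, u \in B x by apply/set0Pn/connected_in_neq0.
have fP x : xchoose (ne x) \in B x by exact: xchooseP.
exists (fun x => xchoose (ne x)) => // x y fxy.
by apply: (disjoint_inj disB) (fP x) _; rewrite fxy.
Qed.

Section MinorSize.

(** Ordered pairs count every edge twice, so that sums of degrees count arcs directly. *)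
Definition arcs (G : sgraph) : {set G * G} := [set p | p.1 -- p.2].

Variables H G : sgraph.
Hypothesis HG : minor H G.

(** Every arc of [H] selects an arc of [G] between its branch sets; disjointness makes this choice
    injective. *)
Lemma minor_size : #|H| <= #|G| /\ #|arcs H| <= #|arcs G|.
Proof.
have [B [conB disB adjB]] := HG.
have disE := disjoint_inj disB.
have [f f_inj fP] := branch_representatives conB disB.
split; first exact: leq_card f_inj.
pose g (p : H * H) := odflt (f p.1, f p.2)
  [pick q : G * G | [&& q.1 \in B p.1, q.2 \in B p.2 & q.1 -- q.2]].
have gP p : p \in arcs H -> [&& (g p).1 \in B p.1, (g p).2 \in B p.2 & (g p).1 -- (g p).2].
  rewrite inE /g => /adjB[u [v [uB vB uv]]]; case: pickP => //= /(_ (u, v)).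
  by rewrite /= uB vB uv.
rewrite -(card_in_imset (f := g)).
  apply: subset_leq_card; apply/subsetP => q /imsetP[p /gP /and3P[_ _ pg] ->].
  by rewrite inE.
move=> p q pH qH gpq; have /and3P[p1 p2 _] := gP p pH; have /and3P[q1 q2 _] := gP q qH.
rewrite -gpq in q1 q2; case: p q {pH qH gpq} p1 p2 q1 q2 => [p1 p2] [q1 q2] /=.
by move=> a b c d; congr pair; [exact: disE a c | exact: disE b d].
Qed.

(** Equal orders turn representatives of the branch sets into a bijection, so the branch sets are
    singletons; equal arc counts leave no further arc in [G]. Hence a proper minor is strictly
    smaller in vertices plus arcs. *)
Lemma minor_eq_size_isomorphic :
  #|H| = #|G| -> #|arcs H| = #|arcs G| -> isomorphic H G.
Proof.
move=> cHG aHG; have [B [conB disB adjB]] := HG.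
have disE := disjoint_inj disB.
have [f f_inj fP] := branch_representatives conB disB.
have f_surj y : y \in codom f by apply: (inj_card_onto f_inj); rewrite cHG.
have BE x u : u \in B x -> u = f x.
  by have /codomP[y ->] := f_surj u => uB; congr (f _); exact: disE (fP y) uB.
have f_adj x y : x -- y -> f x -- f y.
  by case/adjB => u [v [/BE -> /BE -> ]].
have eA : [set (f p.1, f p.2) | p in arcs H] = arcs G.
  apply/eqP; rewrite eqEcard; apply/andP; split.
    by apply/subsetP => q /imsetP[p]; rewrite inE => pH ->; rewrite inE /= f_adj.
  rewrite card_in_imset ?aHG //.
  by move=> [p1 p2] [q1 q2] _ _ /= [/f_inj -> /f_inj ->].
apply/existsP; exists (finfun f); apply/and3P; split.
- by apply/injectiveP => x y; rewrite !ffunE => /f_inj.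
- by apply/forallP => y; have /codomP[x ->] := f_surj y; apply/codomP; exists x; rewrite ffunE.
apply/forallP => x; apply/forallP => y; rewrite !ffunE; apply/eqP.
apply/idP/idP => [fxy|]; last exact: f_adj.
have : (f x, f y) \in arcs G by rewrite inE.
by rewrite -eA => /imsetP[[p1 p2]]; rewrite inE /= => ? [/f_inj -> /f_inj ->].
Qed.

End MinorSize.

Lemma cards_lt2P (T : finType) (X : {set T}) :
  reflect {in X &, forall u v, u = v} (#|X| < 2).
Proof.
rewrite ltnS; apply: (iffP card_le1_eqP) => eqX u v uX vX; exact: (eqX v u).
Qed.

(** Descent on the number of vertices plus arcs, which drops strictly for a proper minor. *)
Lemma minimal_forbidden_minor_exists (P : graph_class) (G : sgraph) :
  ~ P G -> exists2 H, minimal_forbidden_minor P H & minor H G.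
Proof.
have [m leGm] := ubnP (#|G| + #|arcs G|); elim: m G leGm => // m IHm G leGm nPG.
have [minG|] := pselect (forall H, proper_minor H G -> P H).
  by exists G; [split | exact: minor_refl].
case/existsNP => H /not_implyP[[HG nHG] nPH].
have [cHG aHG] := minor_size HG.
have ltHG : #|H| + #|arcs H| < #|G| + #|arcs G|.
  rewrite ltn_neqAle leq_add // andbT; apply: contra nHG => /eqP eHG.
  by apply: minor_eq_size_isomorphic => //; lia.
have [|K minK KH] := IHm H _ nPH; first lia.
by exists K => //; exact: minor_trans KH HG.
Qed.

(** * Shrinking the model of a 2-connected minor *)

(** The host graph stays fixed and only [W] shrinks, which avoids passing to induced subgraphs. *)
Definition model_in (H G : sgraph) (W : {set G}) (B : H -> {set G}) : Prop :=
  [/\ forall x, connected_in (B x),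
      forall x y, x != y -> [disjoint B x & B y],
      forall x y, x -- y -> exists u v, [/\ u \in B x, v \in B y & u -- v]
    & forall x, B x \subset W].

Section Shrink.

Variables H G : sgraph.

(* [W] is the union of [U1], [U2] and [W :&: X], with no edge between [U1] and [U2];
   a branch set meeting [X] is retracted onto [U1 :|: (W :&: X)] by sending [U2] to
   the cut vertex. *)
Lemma model_in_side (W X U1 U2 : {set G}) (B : H -> {set G}) (x0 : H) :
    two_connected H -> model_in W B -> #|X| < 2 ->
    W = U1 :|: U2 :|: (W :&: X) ->
    (forall u v, u \in U1 -> v \in U2 -> ~~ (u -- v)) ->
    [disjoint B x0 & X] -> B x0 \subset U1 ->
  exists B' : H -> {set G}, model_in (U1 :|: (W :&: X)) B'.
Proof.
move=> /andP[_ /forallP conH] [conB disB adjB BW] X2 WE noU dx0 sx0.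
have disE := disjoint_inj disB.
have X1 u v : u \in X -> v \in X -> u = v by move=> uX vX; exact: (cards_lt2P _ X2).
(* [Z] has at most one element because [X] has, so 2-connectedness of [H] keeps its complement
   connected. *)
pose Z := [set x | ~~ [disjoint B x & X]].
have ZP x : reflect (exists2 c, c \in B x & c \in X) (x \in Z).
  rewrite inE; apply: (iffP pred0Pn) => [[c /andP[]]|[c cB cX]]; first by exists c.
  by exists c; rewrite /= cB.
have Z1 x y : x \in Z -> y \in Z -> x = y.
  move=> /ZP[c cB cX] /ZP[d dB dX]; apply: (disE x y c) => //.
  by rewrite (X1 c d).
have Z2 : #|Z| < 2 by apply/cards_lt2P => x y; exact: Z1.
have W_split u : u \in W -> [|| u \in U1, u \in U2 | u \in X].
  by rewrite {1}WE !inE => /orP[/orP[->|->]|/andP[_ ->]]; rewrite ?orbT.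
have notX x u : x \notin Z -> u \in B x -> u \notin X.
  by move=> xZ uB; apply: contra xZ => uX; apply/ZP; exists u.
have B_side x u : x \notin Z -> u \in B x -> u \in U1 -> B x \subset U1.
  move=> xZ uB uU; have /connected_inP[_] := conB x; apply; first by exists u.
  move=> v w vB wB vU vw; have := W_split w (subsetP (BW x) w wB).
  rewrite (negbTE (notX x w xZ wB)) orbF => /orP[//|wU].
  by have := noU v w vU wU; rewrite vw.
have x0Z : x0 \notin Z by rewrite inE negbK.
(* A branch set avoiding [X] lies on one side, and no edge leads from [U1] to [U2]; connectedness of
   [~: Z] spreads the side of [B x0] to all of them. *)
have sideU1 x : x \notin Z -> B x \subset U1.
  have /connected_inP[_ conZ] := implyP (conH Z) Z2.
  move=> xZ; have /subsetP/(_ x) : ~: Z \subset [set y | B y \subset U1].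
    apply: conZ; first by exists x0; [rewrite in_setC | rewrite inE].
    move=> y z; rewrite !in_setC => yZ zZ; rewrite inE [z \in [set _ | _]]inE => sy /adjB[u [v [uB vB uv]]].
    have := W_split v (subsetP (BW z) v vB).
    rewrite (negbTE (notX z v zZ vB)) orbF => /orP[vU|vU].
      by apply: (B_side z v).
    by have := noU u v (subsetP sy u uB) vU; rewrite uv.
  by rewrite in_setC => /(_ xZ); rewrite inE.
pose W1 := U1 :|: (W :&: X).
exists (fun x => B x :&: W1); split; last by move=> x; apply: subsetIr.
- move=> x; have [/ZP[c cB cX]|xZ] := boolP (x \in Z); last first.
    by rewrite (setIidPl _) // (subset_trans (sideU1 x xZ)) // subsetUl.
  have cW : c \in W1 by rewrite !inE cX (subsetP (BW x)) ?orbT.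
  pose f u := if u \in W1 then u else c.
  have -> : B x :&: W1 = f @: B x.
    apply/setP => u; apply/setIP/imsetP => [[uB uW]|[v vB ->]].
      by exists u; rewrite // /f uW.
    by rewrite /f; case: ifP.
  have fX u v : u \in B x -> v \in B x -> u -- v -> u \in W1 -> v \notin W1 -> f u = f v.
    move=> uB vB uv uW vW; have := W_split v (subsetP (BW x) v vB).
    have vW' : v \in W := subsetP (BW x) v vB.
    rewrite /f uW (negbTE vW); move: vW; rewrite !inE vW' andTb negb_or => /andP[/negbTE -> /negbTE ->].
    rewrite orbF => vU2; move: uW; rewrite !inE => /orP[uU|/andP[_ uX]].
      by have := noU u v uU vU2; rewrite uv.
    exact: X1.
  apply: connected_in_imset => // u v uB vB uv.
  have [uW|uW] := boolP (u \in W1); have [vW|vW] := boolP (v \in W1).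
  + by right; rewrite /f uW vW.
  + by left; exact: fX.
  + by left; apply/esym; apply: fX => //; rewrite adj_sym.
  + by left; rewrite /f (negbTE uW) (negbTE vW).
- move=> x y /disB; apply: disjointW; exact: subsetIl.
(* Of two adjacent branch sets at most one meets [X]; the other lies in [U1], so the connecting edge
   survives. *)
- have half x y u v : y \notin Z -> u \in B x -> v \in B y -> u -- v -> u \in W1 /\ v \in W1.
    move=> yZ uB vB uv; have vU := subsetP (sideU1 y yZ) v vB.
    have uW := subsetP (BW x) u uB; split; rewrite !inE ?vU // uW /=.
    have := W_split u uW; case/or3P => [->//|uU|->]; last by rewrite orbT.
    by have := noU v u vU uU; rewrite adj_sym uv.
  move=> x y xy; have [u [v [uB vB uv]]] := adjB x y xy.
  suff [uW vW] : u \in W1 /\ v \in W1 by exists u, v; rewrite !(inE, uB, vB) /= -!in_setI -!in_setU.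
  have [yZ|yZ] := boolP (y \in Z); last exact: half uB vB uv.
  have [xZ|xZ] := boolP (x \in Z).
    by have := Z1 x y xZ yZ => xyE; rewrite xyE adj_irrefl in xy.
  by rewrite adj_sym in uv; have [] := half y x v u xZ vB uB uv.
Qed.

Lemma model_in_size (W : {set G}) (B : H -> {set G}) : model_in W B -> #|H| <= #|W|.
Proof.
move=> [conB disB _ BW].
have [f f_inj fB] := branch_representatives conB disB.
rewrite -(card_imset (mem H) f_inj).
by apply/subset_leq_card/subsetP => _ /imsetP[x _ ->]; exact: subsetP (BW x) _ _.
Qed.

(** Descent on [#|W|]: a separating set of at most one vertex leaves a model on one side, by
    [model_in_side]. The empty [X] is included, so the final [W] is itself connected. *)
Lemma minimal_model (B : H -> {set G}) : two_connected H -> model_in setT B ->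
  exists (W : {set G}) (B' : H -> {set G}), [/\ model_in W B', 2 < #|W|
    & forall X : {set G}, #|X| < 2 -> connected_in (W :\: X)].
Proof.
move=> H2; move: [set: G] B => W B; have [m leWm] := ubnP #|W|.
elim: m W leWm B => // m IHm W leWm B modB.
have W3 : 2 < #|W| by case/andP: H2 => H3 _; apply: leq_trans H3 (model_in_size modB).
have [/forallP con|] := boolP [forall X : {set G}, (#|X| < 2) ==> connected_in (W :\: X)].
  by exists W, B; split=> // X; exact/implyP.
rewrite negb_forall => /existsP[X]; rewrite negb_imply => /andP[X2 nconX].
have [D [conD DW clD]] : exists D : {set G}, [/\ connected_in D, D \subset W :\: X
    & forall x y, x \in D -> y \in W :\: X -> x -- y -> y \in D].
  apply: component_exists; rewrite -card_gt0 cardsD subn_gt0.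
  by have := subset_leq_card (subsetIr W X); lia.
pose E := (W :\: X) :\: D.
have E0 : E != set0.
  apply: contraNneq nconX => E0; suff <- : D = W :\: X by [].
  by apply/eqP; rewrite eqEsubset DW -setD_eq0 -/E E0 eqxx.
have D0 := connected_in_neq0 conD.
have WE : W = D :|: E :|: (W :&: X).
  apply/setP => u; rewrite !inE; have := subsetP DW u; rewrite !inE.
  by case: (u \in D) => [/(_ isT)/andP[_ ->]|_] //=; case: (u \in W); case: (u \in X).
have dDX : [disjoint D & X].
  by apply/pred0P => u /=; apply/negP => /andP[/(subsetP DW)]; rewrite inE => /andP[/negP].
have dEX : [disjoint E & X].
  by apply/pred0P => u /=; rewrite !inE; case: (u \in X); rewrite /= ?andbF.
have dDE : [disjoint D & E].
  by apply/pred0P => u /=; rewrite !inE; case: (u \in D).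
have noE u v : u \in D -> v \in E -> ~~ (u -- v).
  by move=> uD; rewrite inE => /andP[vD vW]; apply: contra vD; exact: clD.
have small (U U' : {set G}) : U' != set0 -> [disjoint U & U'] -> [disjoint U' & X] -> U' \subset W ->
   U \subset W -> #|U :|: (W :&: X)| < m.
  move=> /set0Pn[u uU] dU dX sU' sU; rewrite -ltnS; apply: leq_trans leWm; rewrite ltnS.
  apply/proper_card/properP; split; first by rewrite subUset sU subsetIl.
  exists u; first exact: (subsetP sU').
  rewrite !inE negb_or negb_and; have /pred0P/(_ u) := dU; have /pred0P/(_ u) := dX.
  by rewrite /= uU /= andbT => -> ->; rewrite orbT.
have sDW : D \subset W by apply: subset_trans DW (subsetDl _ _).
have sEW : E \subset W by apply: subset_trans (subsetDl _ _) (subsetDl _ _).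
(* [X] meets at most one branch set, while [H] has more than two vertices. *)
have [x0 dx0] : exists x0, [disjoint B x0 & X].
  apply/existsP; rewrite -[[exists _, _]]negbK negb_exists; apply/negP => /forallP all_meet.
  case/andP: H2 => H3 _; have : #|[set: H]| < 2.
    apply/cards_lt2P => x y _ _; case: modB => _ disB _ _.
    have /pred0Pn[c /andP[/= cB cX]] := all_meet x.
    have /pred0Pn[d /andP[/= dB dX]] := all_meet y.
    have cd : c = d by exact: (cards_lt2P _ X2).
    by have [//|/disB/pred0P/(_ c)] := eqVneq x y; rewrite /= cB cd dB.
  by rewrite cardsT; lia.
have [conB disB adjB BW] := modB.
have BDE : B x0 \subset D \/ B x0 \subset E.
  have BDE u : u \in B x0 -> (u \in D) || (u \in E).
    move=> uB; have := subsetP (BW x0) u uB; rewrite {1}WE inE => /orP[|]; first by rewrite inE.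
    by rewrite inE => /andP[_ uX]; have /pred0P/(_ u) := dx0; rewrite /= uB uX.
  have [BE|/subsetPn[u uB uE]] := boolP (B x0 \subset E); first by right.
  left; have /connected_inP[_] := conB x0; apply.
    by exists u => //; have := BDE u uB; rewrite (negbTE uE) orbF.
  move=> v w vB wB vD vw; have /orP[//|wE] := BDE w wB.
  by have := noE v w vD wE; rewrite vw.
case: BDE => sB.
  have [B' modB'] := model_in_side H2 modB X2 WE noE dx0 sB.
  by apply: (IHm _ _ B' modB'); exact: (small D E).
rewrite (setUC D) in WE; rewrite disjoint_sym in dDE.
have [|B' modB'] := model_in_side H2 modB X2 WE _ dx0 sB.
  by move=> u v uE vD; rewrite adj_sym; exact: noE.
by apply: (IHm _ _ B' modB'); exact: (small E D).
Qed.

End Shrink.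

(** * Forests and the 2-connected minors of their blow-ups *)

(** For distinct [y] and [y'], a path between them avoiding [u], once freed of repetitions, would
    close up to a cycle through [u]. *)
Lemma forest_separates (T : sgraph) (u y y' : T) : forest T -> u -- y -> u -- y' ->
  connect [rel a b : T | [&& a != u, b != u & a -- b]] y y' -> y = y'.
Proof.
move=> fT uy uy' /connectP[p0 pth0 lst0].
have neu v : u -- v -> v != u by apply: contraTneq => ->; rewrite adj_irrefl.
move: lst0; case: (shortenP pth0) => p pth unq _ {p0 pth0} lst.
case: p => [|z p] in pth unq lst *; first by rewrite lst.
have : ucycle (@adj T) [:: u, y, z & p].
  rewrite /ucycle /cycle rcons_path (_ : last u _ = y'); last by rewrite lst.
  rewrite [y' -- u]adj_sym uy' andbT.
  rewrite cons_uniq unq andbT; apply/andP; split.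
    by rewrite /= uy; apply: sub_path pth => a b /and3P[].
  rewrite inE negb_or eq_sym neu //=.
  elim: (z :: p) y pth {unq uy lst} => //= b q IHq y /andP[/and3P[_ bu _]] /IHq.
  by rewrite inE negb_or eq_sym bu.
by move=> /fT.
Qed.

(** A longer cycle would visit the only centre twice or join two leaves. This later yields
    [0 < s]. *)
Lemma forest_star (t : nat) : forest (Kst 1 t).
Proof.
have inl1 (i j : 'I_1) : i = j by rewrite !ord1.
move=> [|x [|y [|z c]]] //= /andP[/= cyc /andP[]].
rewrite !inE !negb_or => /and3P[xy xz xc] /andP[/andP[yz yc] _].
case: x y z xy xz yz cyc xc yc => [x|x] [y|y] [z|z] xy xz yz //=.
- by case/eqP: xz; congr inl; exact: inl1.
case: c => [|[w|w] c] //= _ _; rewrite inE (inl1 y w) eqxx //.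
Qed.

Section Blowup.

Variables (T : sgraph) (V : finType) (pi : V -> option T).

(** The vertex [i] is a copy of [pi i]; vertices sent to [None] are isolated and pad the graph to a
    prescribed order. *)
Definition blowup_adj : rel V := fun i j =>
  if (pi i, pi j) is (Some x, Some y) then x -- y else false.

Lemma blowup_sym : symmetric blowup_adj.
Proof.
by move=> i j; rewrite /blowup_adj; case: (pi i) (pi j) => [x|] [y|] //; exact: adj_sym.
Qed.

Lemma blowup_irrefl : irreflexive blowup_adj.
Proof. by move=> i; rewrite /blowup_adj; case: (pi i) => // x; exact: adj_irrefl. Qed.

Definition blowup : sgraph := SGraph blowup_sym blowup_irrefl.

Lemma blowup_adjP (i j : blowup) :
  reflect (exists x y, [/\ pi i = Some x, pi j = Some y & x -- y]) (i -- j).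
Proof.
rewrite /adj /= /blowup_adj; case: (pi i) (pi j) => [x|] [y|]; apply: (iffP idP) => //.
- by move=> xy; exists x, y.
- by move=> [_ [_ [[<-] [<-]]]].
- by move=> [? [? []]].
- by move=> [? [? []]].
- by move=> [? [? []]].
Qed.

(* The [W] below is 2-connected, and the projection of [W] to [T] cannot contain two
   neighbours of a vertex u outside [A], as the only vertex over u would separate
   them; so it is a star centred in [A]. *)
Lemma two_connected_minor_blowup (A : {set T}) (H : sgraph) : forest T -> stable A ->
    (forall u i j, u \notin A -> pi i = Some u -> pi j = Some u -> i = j) ->
    two_connected H -> minor H blowup ->
  exists2 v, v \in A & minor H (Kst (degree v) #|V|).
Proof.
move=> fT stA fib H2 [B [conB disB adjB]].
have [|W [{conB disB adjB}B [[conB disB adjB BW] W3 conW]]] := @minimal_model H blowup B H2.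
  by split=> // x; exact: subsetT.
have nbr_uniq i j j' u y y' : i \in W -> j \in W -> j' \in W -> u \notin A ->
    pi i = Some u -> pi j = Some y -> pi j' = Some y' -> u -- y -> u -- y' -> y = y'.
  move=> iW jW j'W uA pii pij pij' uy uy'; apply: (forest_separates fT uy uy').
  have /connected_inP[_ con] : connected_in (W :\: [set i]) by apply: conW; rewrite cards1.
  set r := (X in connect X).
  have neu (k : blowup) z : k \in W :\: [set i] -> pi k = Some z -> z != u.
    rewrite !inE => /andP[ki _] pik; apply: contraNneq ki => zu.
    by apply/eqP; apply: fib uA _ pii; rewrite pik zu.
  have neuv (k : blowup) z : pi k = Some z -> u -- z -> k != i.
    by move=> pik; apply: contraTneq => ki; move: pik; rewrite ki pii => -[<-]; rewrite adj_irrefl.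
  have j'Wi : j' \in W :\: [set i] by rewrite !inE j'W (neuv _ y').
  have /subsetP/(_ j' j'Wi) : W :\: [set i] \subset
     [set k : blowup | if pi k is Some z then connect r y z else false].
    apply: con; first by exists j; rewrite !inE ?pij // jW (neuv _ y).
    move=> k l kW lW; rewrite !inE => kc /blowup_adjP[z [w [pik pil zw]]].
    move: kc; rewrite pik pil => yz; apply: connect_trans yz _; apply: connect1.
    by rewrite /r /= (neu k) // (neu l).
  by rewrite inE pij'.
have conW0 : connected_in W by rewrite -[W]setD0; apply: conW; rewrite cards0.
have has_nbr i : i \in W -> exists2 j, j \in W & (i : blowup) -- j.
  move=> iW; have [/exists_inP//|] := boolP [exists j in W, (i : blowup) -- j].
  rewrite negb_exists => /forallP noj.
  have /connected_inP[_ con] := conW0; have : W \subset [set i].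
    apply: con; first by exists i; rewrite ?inE.
    by move=> k l kW lW; rewrite !inE => /eqP -> il; have := noj l; rewrite lW il.
  by move/subset_leq_card; rewrite cards1; lia.
(* If nothing in [W] lay over [A], every vertex of [W] would have at most one neighbour in [W], and
   the connected set [W] at most two elements. *)
have [i0 i0W [v vA pi0]] : exists2 i0, i0 \in W & exists2 v, v \in A & pi i0 = Some v.
  have [/exists_inP[i iW]|] := boolP [exists i in W, if pi i is Some v then v \in A else false].
    by case piE: (pi i) => [v|] // vA; exists i => //; exists v.
  rewrite negb_exists => /forallP noA.
  have notA i u : i \in W -> pi i = Some u -> u \notin A.
    by move=> iW piE; have := noA i; rewrite iW piE.
  have uniq_nbr i j j' : i \in W -> j \in W -> j' \in W ->
      (i : blowup) -- j -> (i : blowup) -- j' -> j = j'.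
    move=> iW jW j'W /blowup_adjP[u [y [pii pij uy]]] /blowup_adjP[u' [y' [pii' pij' uy']]].
    have uu' : u = u' by move: pii'; rewrite pii => -[].
    rewrite -uu' in uy'; have yy' := nbr_uniq _ _ _ _ _ _ iW jW j'W (notA i u iW pii) pii pij pij' uy uy'.
    by apply: (fib y) => //; [exact: notA pij | rewrite yy'].
  have /set0Pn[i iW] := connected_in_neq0 conW0.
  have [j jW ij] := has_nbr i iW.
  have /connected_inP[_ con] := conW0; have : W \subset [set i; j].
    apply: con; first by exists i; rewrite // !inE eqxx.
    move=> k l kW lW; rewrite !inE => /orP[/eqP->|/eqP->] kl.
      by rewrite (uniq_nbr i l j) ?eqxx ?orbT.
    by rewrite (uniq_nbr j l i) ?eqxx // adj_sym.
  by move/subset_leq_card; rewrite cards2; lia.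
exists v => //.
have nbrA z : v -- z -> z \notin A.
  move=> vz; apply/negP => zA.
  by move/forall_inP/(_ v vA)/forall_inP/(_ z zA): stA; rewrite vz.
(* Stability puts each neighbour [z] of [v] outside [A], so by [nbr_uniq] a vertex over [z] has,
   within [W], only neighbours over [v]. *)
have star i : i \in W -> pi i = Some v \/ exists2 z, pi i = Some z & v -- z.
  move=> iW; have /connected_inP[_ con] := conW0.
  have /subsetP/(_ i iW) : W \subset [set i : blowup | if pi i is Some z then (z == v) || (v -- z) else false].
    apply: con; first by exists i0; rewrite // inE pi0 eqxx.
    move=> k l kW lW; rewrite !inE => kc /blowup_adjP[z [w [pik pil zw]]].
    move: kc; rewrite pik pil => /orP[/eqP zv|vz]; first by rewrite -zv zw orbT.
    apply/orP; left; apply/eqP; apply: (nbr_uniq k l i0 z) => //; first exact: nbrA.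
    by rewrite adj_sym.
  rewrite inE; case piE: (pi i) => [z|] // /orP[/eqP->|vz]; first by left.
  by right; exists z.
pose N := [set z | v -- z].
(* The small side is indexed by the neighbours of [v], whose fibres have at most one element; the
   large side has room for all copies of [v]. *)
pose g (i : blowup) : Kst #|N| #|V| :=
  if [pick k : 'I_#|N| | pi i == Some (enum_val k)] is Some k then inl k else inr (enum_rank i).
have g_v i : pi i = Some v -> g i = inr (enum_rank i).
  rewrite /g => ->; case: pickP => //= k /eqP[vk].
  by have := enum_valP k; rewrite -vk inE adj_irrefl.
have g_N i z : z \in N -> pi i = Some z -> exists2 k, g i = inl k & enum_val k = z.
  rewrite /g => zN ->; case: pickP => [k /eqP[->]|/(_ (enum_rank_in zN z))]; first by exists k.
  by rewrite enum_rankK_in ?eqxx.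
have g_inj i j : i \in W -> j \in W -> g i = g j -> i = j.
  move=> iW jW; case: (star i iW) => [pii|[z pii vz]]; case: (star j jW) => [pij|[w pij vw]].
  - by rewrite !g_v // => -[/enum_rank_inj].
  - have [|k -> _] := g_N j w _ pij; first by rewrite inE.
    by rewrite g_v.
  - have [|k -> _] := g_N i z _ pii; first by rewrite inE.
    by rewrite g_v.
  - have [|k -> kz] := g_N i z _ pii; first by rewrite inE.
    have [|l -> lw] := g_N j w _ pij; first by rewrite inE.
    move=> [kl]; apply: (fib z) => //; first exact: nbrA.
    by rewrite pij -lw -kl kz.
have g_adj (i j : blowup) : i \in W -> j \in W -> i -- j -> g i -- g j.
  move=> iW jW /blowup_adjP[z [w [pii pij zw]]].
  have [zv|zv] := eqVneq z v.
    rewrite zv in pii zw; rewrite g_v //.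
    by have [|k -> _] := g_N j w _ pij; first by rewrite inE.
  have vz : v -- z.
    by case: (star i iW) => [|[z']]; rewrite pii => -[] // zE; [rewrite zE eqxx in zv | rewrite zE].
  have wv : w = v.
    by apply: (nbr_uniq i j i0 z) => //; [exact: nbrA | rewrite adj_sym].
  rewrite wv in pij; rewrite (g_v j) //.
  by have [|k -> _] := g_N i z _ pii; first by rewrite inE.
exists (fun x => g @: B x); split.
- move=> x; apply: connected_in_imset => // i j iB jB ij; right.
  by apply: g_adj => //; exact: (subsetP (BW x)).
- move=> x y xy; apply/pred0P => k /=; apply/negP => /andP[/imsetP[i iB ->] /imsetP[j jB gij]].
  have ij : i = j by apply: g_inj gij; [exact: (subsetP (BW x)) | exact: (subsetP (BW y))].
  by have /pred0P/(_ i) := disB x y xy; rewrite /= iB ij jB.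
- move=> x y /adjB[i [j [iB jB ij]]]; exists (g i), (g j); split; rewrite ?imset_f //.
  by apply: g_adj => //; [exact: (subsetP (BW x)) | exact: (subsetP (BW y))].
Qed.

End Blowup.

(** * Membership of forests and blow-ups in the class *)

Section LowerClass.

Variables (P : graph_class) (s : nat).
Hypotheses (P_closed : minor_closed P)
  (P_forb : forall H : sgraph, minimal_forbidden_minor P H -> two_connected H).

(** [T] is a blow-up of itself with [A] empty, so a 2-connected minor would require a vertex of the
    empty set. *)
Lemma forest_in_class (T : sgraph) : forest T -> P T.
Proof.
move=> fT; apply: contrapT => nPT.
have [H minH HT] := minimal_forbidden_minor_exists nPT.
have TB : minor T (blowup (@Some T)) by exact: (@minor_of_embedding T (blowup (@Some T)) id).
have := two_connected_minor_blowup (pi := @Some T) (A := set0) fT _ _ (P_forb minH) (minor_trans HT TB).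
case=> [||v]; rewrite ?inE //; first by apply/forall_inP => x; rewrite inE.
by move=> u i j _ [->] [->].
Qed.

(** A minimal forbidden minor of the blow-up would be a minor of [Kst (degree v) #|V|], hence of
    [Kst s #|V|], which is in the class. *)
Lemma blowup_in_class (T : sgraph) (V : finType) (pi : V -> option T) (A : {set T}) :
    (forall t, P (Kst s t)) -> forest T -> stable A -> {in A, forall v, degree v <= s} ->
    (forall u i j, u \notin A -> pi i = Some u -> pi j = Some u -> i = j) ->
  P (blowup pi).
Proof.
move=> PK fT stA degA fib; apply: contrapT => nPB.
have [H minH HB] := minimal_forbidden_minor_exists nPB.
have [v vA HK] := two_connected_minor_blowup fT stA fib (P_forb minH) HB.
case: minH => nPH _; apply: nPH; apply: P_closed.2 (PK #|V|) _.
exact: minor_trans HK (Kst_minor_mono _ (degA v vA)).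
Qed.

End LowerClass.

(** * Copies as images of embeddings *)

Definition embeddings (T G : sgraph) : {set {ffun T -> G}} :=
  [set f : {ffun T -> G} | injectiveb f && [forall x, forall y, (x -- y) ==> (f x -- f y)]].

Lemma embeddingsP (T G : sgraph) (f : {ffun T -> G}) :
  reflect (injective f /\ forall x y, x -- y -> f x -- f y) (f \in embeddings T G).
Proof.
rewrite inE; apply: (iffP andP) => -[/injectiveP f_inj].
  by move/forallP=> fP; split=> // x y; apply/implyP; move: y; exact/forallP.
by move=> fP; split=> //; apply/forallP => x; apply/forallP => y; apply/implyP; exact: fP.
Qed.

Definition image_subgraph (T G : sgraph) (f : {ffun T -> G}) : {set G} * {set {set G}} :=
  (f @: [set: T], [set [set f p.1; f p.2] | p in arcs T]).

Lemma image_subgraph_iso (T G : sgraph) (f : {ffun T -> G}) : f \in embeddings T G ->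
  is_subgraph (image_subgraph f) && isomorphic T (graph_of_sub (image_subgraph f)).
Proof.
case/embeddingsP => f_inj f_adj; apply/andP; split; first (apply/andP; split).
- apply/subsetP => e /imsetP[[x y]]; rewrite inE /= => xy ->; rewrite inE.
  by apply/existsP; exists (f x); apply/existsP; exists (f y); rewrite f_adj /=.
- apply/forall_inP => e /imsetP[[x y] _ ->]; apply/subsetP => u /=.
  by rewrite !inE => /orP[/eqP->|/eqP->]; exact: imset_f.
have fS x : f x \in (image_subgraph f).1 by exact: imset_f.
apply/existsP; exists [ffun x => exist _ (f x) (fS x)]; apply/and3P; split.
- by apply/injectiveP => x y; rewrite !ffunE => -[/f_inj].
- apply/forallP => -[u uS]; have /imsetP[x _ ux] := uS; apply/codomP; exists x.
  by rewrite ffunE; apply: val_inj.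
apply/forallP => x; apply/forallP => y; rewrite !ffunE; apply/eqP; apply/idP/idP.
  case/andP=> /= fxy /imsetP[[a b]]; rewrite inE /= => ab.
  have xy : x != y by apply: contraTneq fxy => ->; rewrite adj_irrefl.
  rewrite -!imset_set1 -!imsetU => /(imset_inj f_inj) E.
  have : x \in [set a; b] by rewrite -E !inE eqxx.
  have : y \in [set a; b] by rewrite -E !inE eqxx orbT.
  rewrite !inE => /orP[/eqP ya|/eqP yb] /orP[/eqP xa|/eqP xb].
  - by rewrite xa ya eqxx in xy.
  - by rewrite xb ya adj_sym.
  - by rewrite xa yb.
  - by rewrite xb yb eqxx in xy.
move=> xy; apply/andP; split; first exact: f_adj.
by apply/imsetP; exists (x, y); rewrite ?inE.
Qed.

(** Each copy is the image of an embedding. Overcounting by the automorphisms of [T] costs only a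
    constant factor. *)
Lemma copies_le_embeddings (T G : sgraph) : copies T G <= #|embeddings T G|.
Proof.
apply: leq_trans (leq_imset_card (@image_subgraph T G) _).
apply/subset_leq_card/subsetP => -[A E]; rewrite inE => /andP[/andP[/= EG /forall_inP EA]].
case/existsP=> g /and3P[/injectiveP g_inj /forallP g_surj /forallP g_adj].
have g_adjE x y : sub_adj (g x) (g y) = (x -- y) by apply/eqP; exact: (forallP (g_adj x) y).
pose f := [ffun x => val (g x)].
apply/imsetP; exists f.
  apply/embeddingsP; split=> [x y|x y]; first by rewrite !ffunE => /val_inj/g_inj.
  by rewrite -g_adjE !ffunE => /andP[].
have gK u (uA : u \in A) : exists x, f x = u.
  by have /codomP[x gx] := g_surj (exist _ u uA); exists x; rewrite ffunE -gx.
congr pair.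
  apply/setP => u; apply/idP/imsetP => [/gK[x <-]|[x _ ->]]; first by exists x.
  by rewrite ffunE; exact: (valP (g x)).
apply/setP => e; apply/idP/imsetP => [eE|[[x y]]].
  have := subsetP EG e eE; rewrite inE => /existsP[u /existsP[v /andP[uv /eqP eE']]].
  have /subsetP eA := EA e eE.
  have [x xu] : exists x, f x = u by apply: gK; apply: eA; rewrite eE' !inE eqxx.
  have [y yv] : exists x, f x = v by apply: gK; apply: eA; rewrite eE' !inE eqxx orbT.
  exists (x, y); last by rewrite /= xu yv.
  rewrite inE /= -g_adjE; apply/andP; move: xu yv; rewrite !ffunE => -> ->.
  by rewrite -eE'.
by rewrite inE /= -g_adjE => /andP[_ eE] ->; rewrite !ffunE.
Qed.

(** * Many copies of a forest in a blow-up *)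

Section LowerCount.

Variables (T : sgraph) (V : finType) (pi : V -> option T).

(** Sections of [pi] are embeddings, and [pi] recovers a section from its image, so distinct
    sections give distinct copies. *)
Lemma copies_blowup : \prod_(x : T) #|[set i | pi i == Some x]| <= copies T (blowup pi).
Proof.
pose Sec : {set {ffun T -> blowup pi}} := [set f : {ffun T -> blowup pi} | [forall x, pi (f x) == Some x]].
have SecP f : f \in Sec -> forall x, pi (f x) = Some x.
  by rewrite inE => /forallP fP x; apply/eqP.
have Sec_emb f : f \in Sec -> f \in embeddings T (blowup pi).
  move=> /SecP fP; apply/embeddingsP; split=> [x y fxy|x y xy].
    by have := fP x; rewrite fxy fP => -[].
  by apply/blowup_adjP; exists x, y; rewrite !fP.
have -> : \prod_(x : T) #|[set i | pi i == Some x]| = #|Sec|.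
  rewrite -(@eq_card _ (family (fun x => [pred i | pi i == Some x]))); last first.
    by move=> f; rewrite !inE.
  rewrite card_family foldrE big_map enumT; apply: eq_bigr => x _.
  by apply: eq_card => i; rewrite inE.
rewrite -(card_in_imset (f := @image_subgraph T (blowup pi))); last first.
  move=> f g /SecP fP /SecP gP [fg _]; apply/ffunP => x.
  have : f x \in g @: [set: T] by rewrite -fg imset_f.
  by case/imsetP => y _ E; move: (fP x); rewrite E gP => -[->].
apply/subset_leq_card/subsetP => _ /imsetP[f /Sec_emb fE ->]; rewrite inE.
exact: image_subgraph_iso.
Qed.

End LowerCount.

(** Indices are assigned to vertices of [T] by their residue modulo [#|T|.+1], and a vertex outside
    [A] keeps only its first index. The successor keeps the modulus positive for empty [T]; the
    residue [#|T|] goes to [None]. *)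
Lemma blowup_map_exists (T : sgraph) (A : {set T}) (n : nat) : #|T| < n ->
  exists pi : 'I_n -> option T,
    (forall u i j, u \notin A -> pi i = Some u -> pi j = Some u -> i = j) /\
    (n %/ #|T|.+1) ^ #|A| <= \prod_(x : T) #|[set i | pi i == Some x]|.
Proof.
move=> Tn; set k := #|T|.+1.
pose c (i : nat) : option T := omap enum_val (insub (i %% k) : option 'I_#|T|).
have cE i x : c i = Some x <-> i %% k = enum_rank x.
  rewrite /c; case: insubP => [r _ ri|rT] /=; split.
  - by case=> <-; rewrite enum_valK.
  - by rewrite -ri => /val_inj ->; rewrite enum_rankK.
  - by [].
  - by move=> E; rewrite E ltn_ord in rT.
pose pi (i : 'I_n) := if c i is Some x then if (i < k) || (x \in A) then Some x else None else None.
have piE i x : pi i = Some x <-> i %% k = enum_rank x /\ ((i < k) || (x \in A)).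
  rewrite -cE /pi; case: (c i) => [y|]; last by split=> // -[].
  case: ifP => H; split=> //.
  - by case=> <-.
  - by case=> -[->].
  - by case=> -[yx]; rewrite -yx H.
exists pi; split.
  move=> u i j uA /piE[ik]; rewrite (negbTE uA) orbF => ik' /piE[jk].
  rewrite (negbTE uA) orbF => jk'; apply: val_inj.
  by rewrite /= -(modn_small ik') -(modn_small jk') ik jk.
rewrite -prod_nat_const big_mkcond /=; apply: leq_prod => x _.
have rk : enum_rank x < k by rewrite ltnS ltnW.
case: ifP => xA; last first.
  rewrite card_gt0; apply/set0Pn; exists (Ordinal (leq_trans rk Tn)).
  by rewrite inE; apply/eqP/piE; rewrite /= rk modn_small.
have lt_n (q : 'I_(n %/ k)) : q * k + enum_rank x < n.
  apply: (@leq_trans ((n %/ k) * k)); last exact: leq_divM.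
  apply: (@leq_trans (q.+1 * k)); last by rewrite leq_mul2r ltn_ord orbT.
  by rewrite mulSn addnC ltn_add2r.
rewrite -[n %/ k]card_ord -(card_imset (f := fun q => Ordinal (lt_n q))); last first.
  move=> q r [/eqP]; rewrite eqn_add2r eqn_mul2r => /eqP E; exact: val_inj.
apply/subset_leq_card/subsetP => _ /imsetP[q _ ->]; rewrite inE.
by apply/eqP/piE; rewrite /= xA orbT modnMDl modn_small.
Qed.

(** * Arcs inside a vertex set *)

Section ArcsIn.

Variable G : sgraph.
Implicit Types U : {set G}.

Definition nbrs_in U (x : G) : {set G} := [set y in U | x -- y].

Definition arcs_in U : {set G * G} := [set p in arcs G | (p.1 \in U) && (p.2 \in U)].

Lemma card_arcs_from (R : rel G) U :
  #|[set p : G * G | (p.1 \in U) && R p.1 p.2]| = \sum_(x in U) #|[set y | R x y]|.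
Proof.
rewrite -sum1_card (eq_bigl (fun p : G * G => (p.1 \in U) && R p.1 p.2)); last first.
  by move=> p; rewrite inE.
rewrite -(pair_big_dep (mem U) R (fun _ _ => 1)) /=; apply: eq_bigr => x _.
by rewrite sum1_card; apply: eq_card => y; rewrite inE.
Qed.

Lemma card_arcs_in U : #|arcs_in U| = \sum_(x in U) #|nbrs_in U x|.
Proof.
rewrite -(card_arcs_from (fun x y => (y \in U) && (x -- y))).
by apply: eq_card => p; rewrite !inE; case: (_ -- _); rewrite ?andbT ?andbF.
Qed.

Lemma arcs_in_setD1 U v : #|arcs_in U| <= #|arcs_in (U :\ v)| + 2 * #|nbrs_in U v|.
Proof.
set A := arcs_in _; set N := nbrs_in U v.
have : A \subset arcs_in (U :\ v) :|: (setX [set v] N :|: setX N [set v]).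
  apply/subsetP => -[x y]; rewrite !inE /= => /and3P[xy xU yU].
  rewrite xy xU yU /=; case: (eqVneq x v) => [xv|_] /=.
    by rewrite -xv xy.
  case: (eqVneq y v) => [yv|_] //=; by rewrite -yv adj_sym xy.
move/subset_leq_card/leq_trans; apply; apply: leq_trans (leq_card_setU _ _) _.
rewrite leq_add2l; apply: leq_trans (leq_card_setU _ _) _.
by rewrite !cardsX !cards1; lia.
Qed.

End ArcsIn.

(** * Clique minors in dense graphs *)

Section CliqueMinor.

Definition touching (G : sgraph) (A B : {set G}) : bool :=
  [disjoint A & B] && [exists u in A, exists v in B, u -- v].

(** A model of the complete graph on [k] vertices inside [U]. As a list it grows by one cons and is
    lifted through a contraction by [map]. *)
Definition clique_minor_in (G : sgraph) (k : nat) (U : {set G}) : Prop :=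
  exists l : seq {set G}, [/\ size l = k,
    forall A, A \in l -> connected_in A /\ A \subset U & pairwise (@touching G) l].

Section Contract.

Variables (G : sgraph) (u v : G).

(** Contracts [v] into [u] on the same vertex type: [v] remains as an isolated vertex and is removed
    from the set [U] instead. *)
Definition contract_adj : rel G := fun x y =>
  [&& x != v, y != v, x != y & [|| x -- y, (x == u) && (v -- y) | (y == u) && (v -- x)]].

Lemma contract_sym : symmetric contract_adj.
Proof.
move=> x y; rewrite /contract_adj [y == x]eq_sym (adj_sym y x).
by case: (x != v); case: (y != v) => //=; rewrite [X in _ || X]orbC.
Qed.

Lemma contract_irrefl : irreflexive contract_adj.
Proof. by move=> x; rewrite /contract_adj eqxx /= !andbF. Qed.

Definition contract : sgraph := SGraph contract_sym contract_irrefl.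

Hypothesis uv : u -- v.

Let vu : u != v. Proof. by apply: contraTneq uv => ->; rewrite adj_irrefl. Qed.

(** Contraction loses the edge [uv] and one edge for each common neighbour, each counted as two
    arcs. *)
Lemma arcs_in_contract (U : {set G}) : u \in U -> v \in U ->
  #|arcs_in U| <=
    #|arcs_in (U :\ v : {set contract})| + 2 * #|nbrs_in U u :&: nbrs_in U v|.+1.
Proof.
move=> uU vU; set N := nbrs_in U v; set C := _ :&: N.
(* [X] collects the neighbours of [v] that become new neighbours of [u]. *)
set X := N :\: (u |: nbrs_in U u).
have NX : #|N| <= #|X| + #|C|.+1.
  have : N \subset X :|: (u |: C).
    apply/subsetP => x xN; rewrite in_setU [x \in X]in_setD [x \in u |: C]in_setU1 [x \in C]in_setI xN.
    by rewrite in_setU1 !andbT; case: (x == u); case: (x \in _).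
  move/subset_leq_card/leq_trans; apply; apply: leq_trans (leq_card_setU _ _) _.
  by rewrite leq_add2l cardsU1; case: (_ \notin _).
have uX : u \notin X by rewrite !inE eqxx.
have XP x : x \in X -> [/\ x \in U, x != v, x != u, v -- x & ~~ (u -- x)].
  rewrite !inE negb_or negb_and => /andP[/andP[xu xn] /andP[xU vx]].
  rewrite xU /= in xn; split=> //.
  by apply: contraTneq vx => ->; rewrite adj_irrefl.
have : arcs_in (U :\ v) :|: (setX [set u] X :|: setX X [set u]) \subset
    arcs_in (U :\ v : {set contract}).
  apply/subsetP => -[x y]; rewrite in_setU => /orP[].
    rewrite !inE /= /contract_adj => /and3P[xy /andP[-> ->] /andP[-> ->]].
    rewrite xy !andbT /=.
    by apply: contraTneq xy => ->; rewrite adj_irrefl.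
  rewrite !in_setU !in_setX !in_set1 /= => /orP[/andP[/eqP -> /XP[yU yv yu vy _]]|/andP[/XP[xU xv xu vx _] /eqP ->]].
    by rewrite !inE /= /contract_adj yU uU yv vu eq_sym yu eqxx vy /= orbT.
  by rewrite !inE /= /contract_adj xU uU xv vu xu eqxx vx /= !orbT.
move/subset_leq_card; rewrite cardsU.
have -> : arcs_in (U :\ v) :&: (setX [set u] X :|: setX X [set u]) = set0.
  apply/setP => -[x y]; rewrite in_set0; apply/negP; rewrite in_setI => /andP[].
  rewrite in_set => /andP[]; rewrite in_set /= => xy _.
  rewrite in_setU !in_setX !in_set1 /= => /orP[/andP[/eqP xu /XP[_ _ _ _]]|/andP[/XP[_ _ _ _] ux /eqP yu]].
    by rewrite -xu xy.
  by rewrite -yu adj_sym xy in ux.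
rewrite cards0 subn0 cardsU.
have -> : setX [set u] X :&: setX X [set u] = set0.
  apply/setP => -[x y]; rewrite in_set0; apply/negP; rewrite in_setI !in_setX !in_set1 /=.
  by case/andP=> /andP[/eqP -> _] /andP[uX' _]; rewrite uX' in uX.
rewrite cards0 subn0 !cardsX !cards1.
have num (e a n x b c : nat) : e <= a + 2 * n -> n <= x + c.+1 ->
    a + (1 * x + x * 1) <= b -> e <= b + 2 * c.+1 by lia.
exact: num (arcs_in_setD1 U v) NX.
Qed.

(** A branch set containing [u] takes in [v] as well; the edge [uv] keeps it connected. *)
Lemma clique_minor_in_contract (k : nat) (U : {set G}) : u \in U -> v \in U ->
  @clique_minor_in contract k (U :\ v) -> clique_minor_in k U.
Proof.
move=> uU vU [l [szl lP touch_l]].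
pose C (x : contract) : {set G} := if x == u then [set u; v] else [set x].
pose h (A : {set contract}) := \bigcup_(x in A) C x.
have C_self x : x \in C x by rewrite /C; case: eqP => [->|_]; rewrite !inE eqxx.
have C_adj (x y : contract) : x -- y -> exists a b, [/\ a \in C x, b \in C y & a -- b].
  rewrite {1}/adj /= /contract_adj => /and4P[_ _ _ /or3P[xy|/andP[/eqP-> vy]|/andP[/eqP-> vx]]].
  - by exists x, y.
  - by exists v, y; split=> //; rewrite /C eqxx !inE eqxx orbT.
  - exists x, v; split=> //; first by rewrite /C eqxx !inE eqxx orbT.
    by rewrite adj_sym.
have C_con x : connected_in (C x).
  rewrite /C; case: eqP => _; last exact: connected_in1.
  apply/connected_inP; split; first by apply/set0Pn; exists u; rewrite !inE eqxx.
  have uI : u \in [set u; v] by rewrite !inE eqxx.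
  have vI : v \in [set u; v] by rewrite !inE eqxx orbT.
  move=> X [a aI aX] clX; have : (u \in X) && (v \in X).
    move: aI aX; rewrite !inE => /orP[/eqP->|/eqP->] aX; rewrite aX ?andbT /=.
      exact: clX uv.
    by apply: (clX v); rewrite // adj_sym.
  by move=> /andP[uX vX]; apply/subsetP => b; rewrite !inE => /orP[/eqP->|/eqP->].
have C_dis x y a : x != v -> y != v -> a \in C x -> a \in C y -> x = y.
  rewrite /C => xv yv; case: (eqVneq x u) => [->|xu]; case: (eqVneq y u) => [->|yu] //; rewrite !inE.
  - by move=> /orP[]/eqP-> /eqP // E; rewrite -E eqxx in yv.
  - by move=> /eqP-> /orP[/eqP|/eqP] // E; rewrite E eqxx in xv.
  - by move=> /eqP-> /eqP.
exists (map h l); split; first by rewrite size_map.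
  move=> _ /mapP[A /lP[conA sA] ->]; split.
    apply: connected_in_bigcup => // x y _ _ /C_adj[a [b [aC bC ab]]].
    by exists a, b; split=> //; right.
  apply/bigcupsP => x /(subsetP sA); rewrite !inE => /andP[_ xU].
  by rewrite /C; case: eqP => _; apply/subsetP => a; rewrite !inE; [case/orP|]; move=> /eqP->.
rewrite pairwise_map.
have := touch_l; apply: (@sub_in_pairwise _ (mem l)); last by apply/allP.
move=> A B Al Bl /andP[disAB /exists_inP[x xA /exists_inP[y yB]]].
have [_ /subsetP sA] := lP A Al; have [_ /subsetP sB] := lP B Bl.
case/C_adj=> a [b [aC bC ab]]; apply/andP; split; last first.
  apply/exists_inP; exists a; first by apply/bigcupP; exists x.
  by apply/exists_inP; exists b => //; apply/bigcupP; exists y.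
apply/pred0P => c /=; apply/negP => /andP[/bigcupP[w wA cw] /bigcupP[z zB cz]].
have := sA w wA; have := sB z zB; rewrite !inE => /andP[zv _] /andP[wv _].
by have /pred0P/(_ w) := disAB; rewrite /= wA (C_dis w z c) ?zB.
Qed.

End Contract.

(* If every edge of [U] lies in at least [2 ^ k] triangles of [U], the neighbourhood of
   any vertex of an edge is dense enough for induction on [k]; otherwise contract an
   edge lying in fewer triangles. *)
Lemma dense_clique_minor (k : nat) (G : sgraph) (U : {set G}) :
  U != set0 -> 2 ^ k * #|U| <= #|arcs_in U| -> clique_minor_in k U.
Proof.
elim: k G U => [|k IHk] G U; first by exists [::].
have [m leUm] := ubnP #|U|; elim: m G U leUm => // m IHm G U leUm U0 dense.
have [/existsP[[u v]]|] := boolP [exists p in arcs_in U, #|nbrs_in U p.1 :&: nbrs_in U p.2| < 2 ^ k].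
  rewrite inE inE /= => /andP[/and3P[uv uU vU] few].
  have lt := arcs_in_contract uv uU vU.
  have cU : #|U| = #|U :\ v|.+1 by rewrite (cardsD1 v) vU.
  apply: (clique_minor_in_contract uv uU vU); apply: IHm; first by move: leUm; rewrite cU.
    apply/set0Pn; exists u; rewrite !inE uU andbT.
    by apply: contraTneq uv => ->; rewrite adj_irrefl.
  (* The contraction loses at most [2 ^ k.+1] arcs and one vertex, so the density hypothesis
     persists. *)
  have num (p c r a b : nat) : 2 * p * r.+1 <= a -> a <= b + 2 * c.+1 -> c < p -> 2 * p * r <= b by nia.
  move: dense; rewrite cU expnS.
  move=> H; exact: (num _ _ _ _ _ H lt few).
rewrite negb_exists => /forallP many.
have [[v w]] : exists p, p \in arcs_in U.
  apply/set0Pn; rewrite -card_gt0; apply: leq_trans dense.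
  by rewrite muln_gt0 expn_gt0 card_gt0 U0.
rewrite inE inE /= => /and3P[vw vU wU].
have [||l [szl lP tl]] := IHk G (nbrs_in U v).
- by apply/set0Pn; exists w; rewrite inE wU.
- rewrite card_arcs_in mulnC -sum_nat_const; apply: leq_sum => y; rewrite inE => /andP[yU vy].
  have := many (v, y); rewrite !inE vy vU yU /= -leqNgt => /leq_trans; apply.
  by apply/subset_leq_card/subsetP => z; rewrite !inE => /andP[/andP[-> ->] /andP[_ ->]].
(* The vertex [v] is adjacent to its whole neighbourhood and serves as the additional branch set. *)
exists ([set v] :: l); split; first by rewrite /= szl.
  move=> A; rewrite inE => /orP[/eqP->|/lP[conA sA]].
    by split; [exact: connected_in1 | rewrite sub1set].
  split=> //; apply: subset_trans sA _; apply/subsetP => z; by rewrite inE => /andP[].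
rewrite pairwise_cons tl andbT; apply/allP => A /lP[/connected_in_neq0/set0Pn[a aA] /subsetP sA].
apply/andP; split.
  rewrite disjoints1; apply/negP => /sA; by rewrite inE adj_irrefl andbF.
apply/exists_inP; exists v; rewrite ?inE //; apply/exists_inP; exists a => //.
by have := sA a aA; rewrite inE => /andP[].
Qed.

Lemma clique_minor_Kst (G : sgraph) (s t : nat) (U : {set G}) :
  clique_minor_in (s + t) U -> minor (Kst s t) G.
Proof.
move=> [l [szl lP /(pairwiseP set0) tl]].
have tch i j : i < j -> j < s + t -> touching (nth set0 l i) (nth set0 l j).
  by move=> ij jst; apply: tl => //; rewrite inE szl //; exact: ltn_trans jst.
(* The first [s] branch sets form one side, the remaining [t] the other. *)
pose idx (x : Kst s t) : nat := match x with inl i => i | inr j => s + j end.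
have idx_lt x : idx x < s + t by case: x => /= i; [exact: ltn_addr | rewrite ltn_add2l].
have idx_inj x y : idx x = idx y -> x = y.
  case: x y => [i|i] [j|j] /= E.
  - by congr inl; exact: val_inj.
  - by have := ltn_ord i; rewrite E; lia.
  - by have := ltn_ord j; rewrite -E; lia.
  - by congr inr; apply: val_inj; apply/eqP; rewrite -(eqn_add2l s) E.
have adjs x y : idx x != idx y -> [disjoint nth set0 l (idx x) & nth set0 l (idx y)] /\
    exists u v, [/\ u \in nth set0 l (idx x), v \in nth set0 l (idx y) & u -- v].
  rewrite neq_ltn => /orP[xy|yx].
    have /andP[-> /exists_inP[u ux /exists_inP[v vy uv]]] := tch _ _ xy (idx_lt y).
    by split=> //; exists u, v.
  have /andP[dis /exists_inP[u ux /exists_inP[v vy uv]]] := tch _ _ yx (idx_lt x).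
  by rewrite disjoint_sym; split=> //; exists v, u; rewrite adj_sym.
exists (fun x => nth set0 l (idx x)); split.
- by move=> x; case: (lP (nth set0 l (idx x))) => //; rewrite mem_nth // szl.
- by move=> x y xy; apply: (adjs x y _).1; apply: contraNneq xy => /idx_inj ->.
- move=> x y xy; apply: (adjs x y _).2; apply: contraTneq xy => /idx_inj ->.
  by rewrite adj_irrefl.
Qed.

End CliqueMinor.

(** Contrapositive of [dense_clique_minor] for [k = s + t], as [Kst s t] is a subgraph of the
    complete graph on [s + t] vertices. *)
Lemma arcs_bound (G : sgraph) (s t : nat) :
  ~ minor (Kst s t) G -> #|arcs G| <= 2 ^ (s + t) * #|G|.
Proof.
move=> nK; rewrite leqNgt; apply/negP => dense; apply: nK.
apply: (@clique_minor_Kst G s t setT); apply: dense_clique_minor.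
  by apply: contraTneq dense => E; rewrite -cardsT E cards0 muln0 -leqNgt; apply/eq_leq/eqP;
     rewrite cards_eq0; apply/eqP/setP => -[x y]; have := in_set0 x; rewrite -E inE.
rewrite cardsT; apply: leq_trans (ltnW dense) _.
by apply/subset_leq_card/subsetP => p pA; rewrite inE pA !inE.
Qed.

(** * Leaves, boundaries and edge covers in forests *)

Section Forest.

Variable T : sgraph.
Hypothesis fT : forest T.

(** Otherwise every path in [U] could be extended at its front without going back, and acyclicity
    would make it arbitrarily long. *)
Lemma forest_leaf (U : {set T}) : U != set0 -> exists2 v, v \in U & #|nbrs_in U v| <= 1.
Proof.
move=> U0; have [/exists_inP//|] := boolP [exists v in U, #|nbrs_in U v| <= 1].
rewrite negb_exists => /forallP deg2.
have long n : exists x p, [/\ size p = n, uniq (x :: p), path (@adj T) x p & x \in U].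
  elim: n => [|n [x [p [szp unq pth xU]]]]; first by case/set0Pn: U0 => x xU; exists x, [::].
  (* [head x p] is the predecessor of [x] on the path; for empty [p] the default [x] is harmless,
     being no neighbour of itself. *)
  have [y] : exists y, y \in nbrs_in U x :\ head x p.
    apply/set0Pn; rewrite -card_gt0; have := deg2 x; rewrite xU /= -ltnNge.
    by rewrite (cardsD1 (head x p)); case: (_ \in _); rewrite ?add1n ?add0n => // /ltnW.
  rewrite !inE => /and3P[yh yU xy].
  have yx : y != x by apply: contraTneq xy => ->; rewrite adj_irrefl.
  exists y, (x :: p); have [yp|yp] := boolP (y \in p); last first.
    by rewrite cons_uniq inE negb_or yx yp unq /= szp adj_sym xy pth.
  exfalso; case/path.splitP: yp unq pth yh {szp} => p1 p2 unq pth yh.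
  have /fT : ucycle (@adj T) (x :: rcons p1 y).
    apply/andP; split.
      rewrite /cycle rcons_path last_rcons adj_sym xy andbT.
      by move: pth; rewrite cat_path => /andP[].
    by move: unq; rewrite -cat_cons cat_uniq => /andP[].
  by rewrite /= size_rcons; case: p1 yh {unq pth} => //=; rewrite eqxx.
have [x [p [szp unq _ _]]] := long #|T|.
by have := max_card (mem (x :: p)); rewrite (card_uniqP unq) /= szp ltnn.
Qed.

(** The usual bound of [#|U| - 1] on the number of edges, doubled; the induction deletes a leaf. *)
Lemma forest_arcs_in (U : {set T}) : U != set0 -> #|arcs_in U| + 2 <= 2 * #|U|.
Proof.
have [m] := ubnP #|U|; elim: m U => // m IHm U leUm U0.
have [v vU Nv] := forest_leaf U0.
have cU : #|U| = #|U :\ v|.+1 by rewrite (cardsD1 v) vU.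
have [U'0|U'0] := eqVneq (U :\ v) set0.
  rewrite cU U'0 cards0; suff -> : arcs_in U = set0 by rewrite cards0.
  have /cards_lt2P U1 : #|U| < 2 by rewrite cU U'0 cards0.
  apply/setP => -[x y]; rewrite in_set0; apply/negP; rewrite !inE => /and3P[/= xy xU yU].
  by rewrite (U1 x y) ?adj_irrefl in xy.
have lt : #|U :\ v| < m by rewrite -ltnS -cU.
have := IHm _ lt U'0; have := arcs_in_setD1 U v; rewrite cU; lia.
Qed.

Definition boundary (D : {set T}) : {set T} := [set y | (y \notin D) && [exists x in D, x -- y]].

(* Count the arcs between vertices of [D :|: boundary D]: at least
   2 (s + 1) |D| - |arcs_in D| of them, and both sides are bounded by [forest_arcs_in]. *)
Lemma boundary_large (s : nat) (D : {set T}) : 0 < s -> D != set0 ->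
  {in D, forall x, s < degree x} -> s < #|boundary D|.
Proof.
move=> s0 D0 degD; set M := boundary D.
pose E1 := [set p : T * T | (p.1 \in D) && (p.1 -- p.2)].
pose E2 := [set p : T * T | (p.2 \in D) && (p.1 -- p.2)].
have cE1 : s.+1 * #|D| <= #|E1|.
  by rewrite card_arcs_from mulnC -sum_nat_const; apply: leq_sum => x xD; exact: degD.
have cE2 : #|E2| = #|E1|.
  rewrite -(card_imset (f := fun p : T * T => (p.2, p.1)) (mem E1)); last by move=> [a b] [c d] [-> ->].
  apply: eq_card => -[a b]; apply/idP/imsetP => [|[[c d] cd [-> ->]]].
    by rewrite inE /= => /andP[bD ab]; exists (b, a); rewrite // inE /= bD adj_sym.
  by move: cd; rewrite !inE /= adj_sym.
have E12 : E1 :&: E2 = arcs_in D.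
  by apply/setP => -[a b]; rewrite !inE /=; case: (a \in D); case: (b \in D); case: (a -- b).
have sE : E1 :|: E2 \subset arcs_in (D :|: M).
  have inM a b : a \in D -> a -- b -> b \in D :|: M.
    move=> aD ab; rewrite in_setU; have [//|bD] := boolP (b \in D).
    by rewrite /= inE bD; apply/exists_inP; exists a.
  apply/subsetP => -[a b]; rewrite in_setU [_ \in arcs_in _]in_set [_ \in arcs T]in_set /=.
  case/orP; rewrite in_set /= => /andP[aD ab]; rewrite ab /=; apply/andP; split.
  - by rewrite in_setU aD.
  - exact: inM ab.
  - by apply: inM aD _; rewrite adj_sym.
  - by rewrite in_setU aD.
have dDM : #|D :|: M| <= #|D| + #|M| by exact: leq_card_setU.
have DM0 : D :|: M != set0.
  by case/set0Pn: D0 => x xD; apply/set0Pn; exists x; rewrite inE xD.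
have := subset_leq_card sE; rewrite cardsU E12 cE2.
have := forest_arcs_in D0; have := forest_arcs_in DM0; have := D0; rewrite -card_gt0.
(* The inequalities combine to m >= (s - 1) d + 2, which is at least s + 1 because d and s are
   positive. *)
move: #|arcs_in D| #|arcs_in (D :|: M)| #|D| #|M| #|D :|: M| #|E1| dDM cE1 => a b d m dm e; nia.
Qed.

(* Koenig's theorem for forests; the loops in [L] stand for single vertices. *)
Lemma forest_edge_cover (U : {set T}) : exists (I : {set T}) (L : seq (T * T)),
  [/\ I \subset U, stable I, size L = #|I|,
      {in L, forall p, (p.1 == p.2) || (p.1 -- p.2)}
    & {in U, forall x, exists2 p, p \in L & (x == p.1) || (x == p.2)}].
Proof.
have [m] := ubnP #|U|; elim: m U => // m IHm U leUm.
have [->|U0] := eqVneq U set0.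
  exists set0, [::]; rewrite cards0; split=> //; last by move=> x; rewrite inE.
  by apply/forall_inP => x; rewrite inE.
have [v vU /card_le1_eqP Nv] := forest_leaf U0.
(* The leaf [v] enters [I], and the edge to its only neighbour in [U] enters [L]; deleting both ends
   leaves no neighbour of [v]. *)
pose U' := U :\: (v |: nbrs_in U v).
have ltU' : #|U'| < m.
  rewrite -ltnS; apply: leq_trans leUm; rewrite ltnS; apply/proper_card/properP.
  by split; [exact: subsetDl | exists v; rewrite // !inE eqxx].
have [I [L [IU stI szL Ladj Lcov]]] := IHm _ ltU'.
have vI : v \notin I by apply/negP => /(subsetP IU); rewrite !inE eqxx.
have vnI x : x \in I -> ~~ (v -- x).
  by move=> /(subsetP IU); rewrite !inE negb_or negb_and => /andP[/andP[_ /orP[/negbTE->|]]].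
(* If [v] has no neighbour in [U], the default turns the new pair into a loop. *)
pose w := if [pick w in nbrs_in U v] is Some w then w else v.
exists (v |: I), ((v, w) :: L); split.
- rewrite subUset sub1set vU; apply: subset_trans IU (subsetDl _ _).
- apply/forall_inP => x xI; apply/forall_inP => y yI; move: xI yI.
  rewrite !inE => /orP[/eqP->|xI] /orP[/eqP->|yI]; first by rewrite adj_irrefl.
  + exact: vnI.
  + by rewrite adj_sym; exact: vnI.
  + by move/forall_inP/(_ x xI)/forall_inP/(_ y yI): stI.
- by rewrite /= szL cardsU1 vI.
- move=> p; rewrite inE => /orP[/eqP->|/Ladj//]; rewrite /w.
  by case: pickP => [z|_] /=; rewrite ?eqxx // inE => /andP[_ ->]; rewrite orbT.
- move=> x xU; have [xU'|] := boolP (x \in U').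
    by have [p pL xp] := Lcov x xU'; exists p; rewrite // inE pL orbT.
  rewrite !inE xU andbT negbK /= => /orP[/eqP->|vx].
    by exists (v, w); rewrite ?inE /= eqxx.
  exists (v, w); rewrite ?inE ?eqxx //= /w; have xN : x \in nbrs_in U v by rewrite inE xU.
  case: pickP => [z zN|/(_ x)]; last by rewrite xN.
  by rewrite (Nv z x zN xN) eqxx orbT.
Qed.

End Forest.

(** * A sunflower bound for families of functions *)

Lemma leq_expl (m n e : nat) : m <= n -> m ^ e <= n ^ e.
Proof. by case: e => // e mn; rewrite leq_exp2r. Qed.

Lemma card_bigcup_leq (I X : finType) (P : {pred I}) (F : I -> {set X}) (c : nat) :
  {in P, forall i, #|F i| <= c} -> #|\bigcup_(i in P) F i| <= #|P| * c.
Proof.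
move=> Fc; rewrite -sum_nat_const.
apply: (leq_trans (n := \sum_(i in P) #|F i|)); last exact: leq_sum.
elim/big_rec2: _ => [|i n A _ le]; first by rewrite cards0.
by apply: leq_trans (leq_card_setU _ _) _; rewrite leq_add2l.
Qed.

(* A sunflower lemma for functions. The values on [U] of a maximal family of members with
   disjoint images of [U] form a small set, which the image of [U] under every member of
   [F] meets; fix one such value and induct on [U]. *)
Lemma sunflower_bound (X Y : finType) (t : nat) (F : {set {ffun X -> Y}}) (U : {set X}) :
    {in F &, forall f g : {ffun _ -> _}, forall x, x \notin U -> f x = g x} ->
    (forall (U' : {set X}) (F' : {set {ffun X -> Y}}), U' != set0 -> U' \subset U -> F' \subset F ->
       {in F' &, forall f g : {ffun _ -> _}, forall x, x \notin U' -> f x = g x} ->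
       {in F' &, forall f g : {ffun _ -> _}, f != g -> [disjoint f @: U' & g @: U']} -> #|F'| <= t) ->
  #|F| <= (t * #|X| * #|X|) ^ #|U|.
Proof.
have [m] := ubnP #|U|; elim: m F U => // m IHm F U leUm agr petal.
have [U0|U0] := eqVneq U set0.
  rewrite U0 cards0 expn0 -ltnS; apply/cards_lt2P => f g fF gF.
  by apply/ffunP => x; apply: agr => //; rewrite U0 inE.
pose dis (F' : {set {ffun X -> Y}}) := (F' \subset F) &&
  [forall f in F', forall g in F', (f != g) ==> [disjoint f @: U & g @: U]].
have dis0 : dis set0.
  by rewrite /dis sub0set; apply/forall_inP => f; rewrite inE.
have [F' /maxsetP[/andP[sF' /forall_inP disF'] maxF'] _] := maxset_exists dis0.
have {}disF' : {in F' &, forall f g : {ffun _ -> _}, f != g -> [disjoint f @: U & g @: U]}.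
  by move=> f g fF gF; apply/implyP; exact: (forall_inP (disF' f fF)).
have cF' : #|F'| <= t.
  apply: (petal U F' U0 (subxx U) sF') => //.
  by move=> f g /(subsetP sF') fF /(subsetP sF') gF; exact: agr.
pose Z := \bigcup_(f in F') f @: U.
have cZ : #|Z| <= t * #|U|.
  apply: leq_trans (leq_mul cF' (leqnn _)); apply: card_bigcup_leq => f _.
  exact: leq_imset_card.
pose Fuz (p : X * Y) := [set f in F | f p.1 == p.2].
have sub : F \subset \bigcup_(p in setX U Z) Fuz p.
  apply/subsetP => f fF.
  suff [u uU fuZ] : exists2 u, u \in U & f u \in Z.
    by apply/bigcupP; exists (u, f u); rewrite inE /= ?uU // fF eqxx.
  have [fF'|fF'] := boolP (f \in F').
    case/set0Pn: U0 => u uU; exists u => //; apply/bigcupP; exists f => //; exact: imset_f.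
  have [/exists_inP[u uU uZ]|] := boolP [exists u in U, f u \in Z]; first by exists u.
  rewrite negb_exists => /forallP noZ; exfalso; move: fF'.
  have fg g : g \in F' -> [disjoint f @: U & g @: U].
    move=> gF'; apply/pred0P => y /=; apply/negP => /andP[/imsetP[u uU ->] fug].
    by have := noZ u; rewrite uU /= => /negP; apply; apply/bigcupP; exists g.
  (* With its image of [U] disjoint from those of all members of [F'], [f] could be added, against
     maximality. *)
  suff disf : dis (f |: F') by rewrite -(maxF' _ disf) ?subsetUr // !inE eqxx.
  rewrite /dis subUset sub1set fF sF' /=.
  apply/forall_inP => g; rewrite in_setU1 => gF; apply/forall_inP => h; rewrite in_setU1 => hF; apply/implyP.
  case/orP: gF => [/eqP->|gF]; case/orP: hF => [/eqP->|hF].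
  - by rewrite eqxx.
  - by move=> _; exact: fg.
  - by move=> _; rewrite disjoint_sym; exact: fg.
  - exact: disF'.
apply: leq_trans (subset_leq_card sub) _.
have cUX : #|U| <= #|X| by exact: max_card.
(* One factor of the bound counts the pairs in [setX U Z]; the remaining ones come from induction on
   [U :\ u]. *)
pose c := (t * #|X| * #|X|) ^ #|U|.-1.
apply: (@leq_trans (#|setX U Z| * c)).
  apply: card_bigcup_leq => -[u z]; rewrite inE /= => /andP[uU _].
  have cU : #|U| = #|U :\ u|.+1 by rewrite (cardsD1 u) uU.
  have FuzF : Fuz (u, z) \subset F by apply/subsetP => f; rewrite inE => /andP[].
  rewrite /c cU; apply: IHm; first by rewrite -ltnS -cU.
    move=> f g; rewrite !inE /= => /andP[fF /eqP fu] /andP[gF /eqP gu] x.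
    by rewrite !inE negb_and negbK => /orP[/eqP->|xU]; [rewrite fu gu | exact: agr].
  move=> U' F0 U'0 sU' sF0; apply: petal => //; first exact: subset_trans sU' (subsetDl _ _).
  exact: subset_trans FuzF.
have cU : #|U| = #|U|.-1.+1 by rewrite prednK // card_gt0.
rewrite [in X in _ <= X]cU expnS -/c leq_mul2r cardsX; apply/orP; right.
by rewrite mulnC; apply: leq_mul => //; apply: leq_trans cZ _; rewrite leq_mul2l cUX orbT.
Qed.

(** * The upper bound on copies *)

Section UpperCount.

Variables (T G : sgraph) (s t : nat).
Hypotheses (fT : forest T) (s0 : 0 < s) (nK : ~ minor (Kst s.+1 t) G).

(* A component [D] of [U] together with the common images of its boundary gives a
   [Kst s.+1 t] minor, whose large side consists of the images of [D]. *)
Lemma petals_bound (U : {set T}) (F : {set {ffun T -> G}}) :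
    U != set0 -> {in U, forall x, s < degree x} -> F \subset embeddings T G ->
    {in F &, forall f g : {ffun _ -> _}, forall x, x \notin U -> f x = g x} ->
    {in F &, forall f g : {ffun _ -> _}, f != g -> [disjoint f @: U & g @: U]} ->
  #|F| <= t.
Proof.
move=> U0 degU /subsetP Femb agr dis; rewrite leqNgt; apply/negP => ltF.
have [D [conD DU clD]] := component_exists U0.
have D0 := connected_in_neq0 conD.
have ltM : s < #|boundary D|.
  by apply: boundary_large => // x xD; exact: degU (subsetP DU x xD).
have [f0 f0F] : exists f0, f0 \in F by apply/set0Pn; rewrite -card_gt0; exact: leq_ltn_trans ltF.
pose w (i : 'I_s.+1) : T := enum_val (widen_ord ltM i).
pose F_ (j : 'I_t) : {ffun T -> G} := enum_val (widen_ord (ltnW ltF) j).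
have wM i : w i \in boundary D by exact: enum_valP.
have F_F j : F_ j \in F by exact: enum_valP.
have w_inj : injective w by move=> i j /enum_val_inj/(congr1 val) E; exact: val_inj.
have F_inj : injective F_ by move=> i j /enum_val_inj/(congr1 val) E; exact: val_inj.
have wD i : w i \notin D by have := wM i; rewrite inE => /andP[].
(* A boundary vertex of [D] inside [U] would already belong to the component [D]; so all members of
   [F] agree on it. *)
have wU i : w i \notin U.
  have := wM i; rewrite inE => /andP[wD' /exists_inP[x xD xw]].
  by apply: contra wD' => wU; exact: clD xD wU xw.
have inl_inr i j : [disjoint [set f0 (w i)] & F_ j @: D].
  rewrite disjoints1; apply/negP => /imsetP[x xD].
  rewrite (agr _ _ f0F (F_F j) _ (wU i)); have /embeddingsP[f_inj _] := Femb _ (F_F j).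
  by move=> /f_inj wx; have := wD i; rewrite wx xD.
have adj_lr i j : exists2 v, v \in F_ j @: D & f0 (w i) -- v.
  have := wM i; rewrite inE => /andP[_ /exists_inP[x xD xw]].
  exists (F_ j x); first exact: imset_f.
  rewrite (agr _ _ f0F (F_F j) _ (wU i)) adj_sym.
  by have /embeddingsP[_] := Femb _ (F_F j); apply.
apply: nK; exists (fun x : Kst s.+1 t => match x with inl i => [set f0 (w i)] | inr j => F_ j @: D end); split.
- move=> [i|j]; first exact: connected_in1.
  apply: connected_in_imset => // x y _ _ xy; right.
  by have /embeddingsP[_] := Femb _ (F_F j); apply.
- move=> [i|i] [j|j] ij.
  + rewrite disjoints1 inE; have /embeddingsP[f_inj _] := Femb _ f0F.
    by rewrite (inj_eq f_inj) (inj_eq w_inj).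
  + exact: inl_inr.
  + by rewrite disjoint_sym; exact: inl_inr.
  + apply: disjointW (dis (F_ i) (F_ j) (F_F i) (F_F j) _); try exact: imsetS.
    by rewrite (inj_eq F_inj).
- move=> [i|i] [j|j] // _.
    by have [v vD wv] := adj_lr i j; exists (f0 (w i)), v; rewrite inE eqxx.
  by have [v vD wv] := adj_lr j i; exists v, (f0 (w j)); rewrite inE eqxx adj_sym.
Qed.

(** The map [h] records an embedding on the covering pairs [L]. Each pair has linearly many possible
    images, by [arcs_bound], and the fibres of [h] are bounded by [sunflower_bound] with
    [petals_bound]. *)
Lemma copies_upper : 0 < #|G| -> copies T G <= (t.+1 * #|T|.+1 * #|T|.+1) ^ #|T| *
  ((1 + 2 ^ (s.+1 + t)) * #|G|) ^ alpha s T.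
Proof.
move=> G0; apply: leq_trans (copies_le_embeddings T G) _.
pose S := [set x : T | degree x <= s].
have [I [L [IS stI szL Ladj Lcov]]] := forest_edge_cover fT S.
(* The diagonal receives the loops of [L]. *)
pose D2 := [set p : G * G | (p.1 == p.2) || (p.1 -- p.2)].
pose h (f : {ffun T -> G}) := [ffun i : 'I_(size L) => (f (tnth (in_tuple L) i).1, f (tnth (in_tuple L) i).2)].
have cD2 : #|D2| <= (1 + 2 ^ (s.+1 + t)) * #|G|.
  rewrite mulnDl mul1n.
  have -> : D2 = [set (x, x) | x : G] :|: arcs G.
    apply/setP => -[x y]; rewrite !inE /=; congr (_ || _).
    by apply/eqP/imsetP => [->|[z _ [-> ->]]] //; exists y.
  apply: leq_trans (leq_card_setU _ _) _; apply: leq_add (arcs_bound nK).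
  by apply: leq_trans (leq_imset_card _ _) _.
have fib q : #|[set f in embeddings T G | h f == q]| <= (t.+1 * #|T|.+1 * #|T|.+1) ^ #|T|.
  apply: (@leq_trans ((t * #|T| * #|T|) ^ #|~: S|)).
    apply: sunflower_bound.
      move=> f g; rewrite !inE => /andP[_ /eqP hf] /andP[_ /eqP hg] x.
      rewrite in_setC negbK => xS; have [p pL xp] := Lcov x xS.
      have /tnthP[i pi] : p \in in_tuple L by [].
      have := congr1 (fun q : {ffun 'I_(size L) -> G * G} => q i) (etrans hf (esym hg)).
      by rewrite !ffunE -pi => -[f1 f2]; case/orP: xp => /eqP->.
    move=> U F U0 UR FE agr dis; apply: petals_bound agr dis => //.
      by move=> x /(subsetP UR); rewrite !inE -ltnNge.
    by apply: subset_trans FE _; apply/subsetP => f; rewrite inE => /andP[].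
  (* The successors make the base positive, so that the exponent can be raised to [#|T|]. *)
  apply: (@leq_trans ((t.+1 * #|T|.+1 * #|T|.+1) ^ #|~: S|)).
    by apply: leq_expl; apply: leq_mul => //; apply: leq_mul.
  by rewrite leq_pexp2l // max_card.
have -> : #|embeddings T G| = \sum_(q in h @: embeddings T G) #|[set f in embeddings T G | h f == q]|.
  rewrite -sum1_card (partition_big_imset h) /=; apply: eq_bigr => q _.
  by rewrite -sum1_card; apply: eq_bigl => f; rewrite inE.
apply: (@leq_trans (#|h @: embeddings T G| * (t.+1 * #|T|.+1 * #|T|.+1) ^ #|T|)).
  by rewrite -sum_nat_const; apply: leq_sum.
rewrite mulnC leq_mul2l; apply/orP; right.
apply: (@leq_trans (#|D2| ^ size L)).
  rewrite -[size L in X in _ <= X]card_ord -card_ffun_on.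
  apply/subset_leq_card/subsetP => _ /imsetP[f /embeddingsP[_ f_adj] ->].
  apply/ffun_onP => i; rewrite ffunE inE /=.
  have /orP[/eqP->|/f_adj->] := Ladj _ (mem_tnth i (in_tuple L)); by rewrite ?eqxx ?orbT.
rewrite szL; apply: (@leq_trans (((1 + 2 ^ (s.+1 + t)) * #|G|) ^ #|I|)).
  by apply: leq_expl.
rewrite leq_pexp2l ?muln_gt0 ?G0 //.
by apply: (leq_bigmax_cond (F := fun A : {set T} => #|A|)); rewrite IS stI.
Qed.

End UpperCount.

(** * Bounds on the maximum number of copies *)

(** A bounded nonempty set of naturals has a maximum, so [xget] does not fall back on its default
    0. *)
Lemma max_copiesP (T : sgraph) (P : graph_class) (n b : nat) :
    (exists2 G, P G & #|G| = n) -> (forall G, P G -> #|G| = n -> copies T G <= b) ->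
  is_maximum (fun m => exists G : sgraph, [/\ P G, #|G| = n & copies T G = m]) (max_copies T P n).
Proof.
move=> [G PG Gn] bound; apply: classical_sets.xgetPex.
pose A m := exists G : sgraph, [/\ P G, #|G| = n & copies T G = m].
have exA : exists m, `[< A m >] by exists (copies T G); apply/asboolP; exists G.
have leA m : `[< A m >] -> m <= b by move=> /asboolP[G' [PG' nG' <-]]; exact: bound.
by have [m /asboolP Am maxm] := ex_maxnP exA leA; exists m; split=> // k Ak; apply/maxm/asboolP.
Qed.

Section MaxCopies.

Variables (P : graph_class) (s : nat) (T : sgraph).
Hypotheses (P_closed : minor_closed P)
  (P_forb : forall H : sgraph, minimal_forbidden_minor P H -> two_connected H)
  (s_max : is_maximum (fun r => forall t : nat, P (Kst r t)) s)
  (fT : forest T).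

Lemma copies_lower (n : nat) : #|T| < n ->
  exists G, [/\ P G, #|G| = n & n ^ alpha s T <= (2 * #|T|.+1) ^ alpha s T * copies T G].
Proof.
move=> Tn; have [A] : {A : {set T} | (A \subset [set x | degree x <= s]) && stable A
    & alpha s T = #|A|}.
  apply: (@eq_bigmax_cond _ (fun A : {set T} => (A \subset [set x | degree x <= s]) && stable A)
    (fun A : {set T} => #|A|)).
  apply/card_gt0P; exists set0; rewrite unfold_in sub0set.
  by apply/forall_inP => x; rewrite inE.
move=> /andP[/subsetP degA stA] ->.
have [pi [fib prodA]] := blowup_map_exists A Tn.
exists (blowup pi); split; last 2 first.
- exact: card_ord.
- apply: leq_trans (leq_mul (leqnn _) (leq_trans prodA (copies_blowup pi))).
  (* Since n >= k, the quotient is positive and n < k (n %/ k + 1) <= 2 k (n %/ k), whence the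
     factor 2. *)
  rewrite -expnMn; apply: leq_expl; set k := #|T|.+1.
  have := divn_eq n k; have := ltn_pmod n (ltn0Sn #|T|).
  have : 0 < n %/ k by rewrite divn_gt0.
  by rewrite -/k; nia.
apply: blowup_in_class fT stA _ fib => //; first exact: s_max.1.
by move=> v /degA; rewrite inE.
Qed.

Lemma max_copies_bounds : exists2 C, 0 < C & forall n, #|T| < n ->
  max_copies T P n <= C * n ^ alpha s T /\ n ^ alpha s T <= C * max_copies T P n.
Proof.
(* Stars are forests, so every [Kst 1 t] is in the class. *)
have s0 : 0 < s by apply: s_max.2 => t; apply: forest_in_class => //; exact: forest_star.
have [t nPK] : exists t, ~ P (Kst s.+1 t).
  by apply/existsNP => PK; have := s_max.2 _ PK; rewrite ltnn.
set a := alpha s T.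
pose C1 := (t.+1 * #|T|.+1 * #|T|.+1) ^ #|T| * (1 + 2 ^ (s.+1 + t)) ^ a.
pose C2 := (2 * #|T|.+1) ^ a.
have up n (G : sgraph) : 0 < n -> P G -> #|G| = n -> copies T G <= C1 * n ^ a.
  move=> n0 PG Gn; rewrite -mulnA -expnMn -Gn; apply: copies_upper => //; last by rewrite Gn.
  by move=> KG; apply: nPK; exact: P_closed.2 KG.
(* The sum dominates both constants, so one constant serves both inequalities. *)
exists (C1 + C2); first by rewrite addn_gt0 [0 < C2]expn_gt0 orbT.
move=> n Tn; have n0 : 0 < n by apply: leq_ltn_trans Tn.
have [G [PG Gn lowG]] := copies_lower Tn.
have [[G' [PG' G'n <-]] maxG] := max_copiesP (ex_intro2 _ _ G PG Gn) (fun G => up n G n0).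
split; first by apply: leq_trans (up n G' n0 PG' G'n) _; rewrite leq_mul2r leq_addr orbT.
apply: leq_trans lowG _; apply: leq_mul; first exact: leq_addl.
by apply: maxG; exists G.
Qed.

End MaxCopies.

(* Imported only here: classical_sets shadows the finset notations used above. *)
From mathcomp Require Import all_order all_algebra.
From mathcomp Require Import classical_sets reals topology normedtype landau.
Import GRing.Theory Num.Theory numFieldNormedType.Exports.
Local Open Scope ring_scope.
Local Open Scope classical_set_scope.

Theorem theorem8 (R : realType) (P : graph_class) (s : nat)
  (P_closed : minor_closed P)
  (P_forb : forall H : sgraph, minimal_forbidden_minor P H -> two_connected H)
  (s_max : is_maximum (fun r => forall t : nat, P (Kst r t)) s)
  (T : sgraph) (T_forest : forest T) :
  (fun n : nat => (max_copies T P n)%:R : R^o)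
    \is 'Theta_\oo (fun n : nat => n%:R ^+ alpha s T : R^o).
Proof.
have [C C0 bounds] := max_copies_bounds P_closed P_forb s_max T_forest.
have C0R : 0 < C%:R :> R by rewrite ltr0n.
(* The lower constant is the inverse of [C], as [C] multiplies the number of copies in [low]. *)
rewrite qualifE; apply/asboolP; exists (C%:R^-1, C%:R) => /=; first by rewrite invr_gt0 C0R.
exists #|T|.+1 => // n /bounds[up low].
rewrite -natrX !normr_nat; split; last by rewrite -natrM ler_nat.
by rewrite mulrC ler_pdivrMr // -natrM ler_nat mulnC.
Qed.
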